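(* Let $\Lambda$ be a cyclic Nakayama algebra, and let $\boldsymbol\varepsilon(\Lambda)$ and $\boldsymbol\eta(\Lambda)$ be its syzygy filtered algebra and cosyzygy filtered algebra, respectively. Then there is an algebra isomorphism $$\boldsymbol\varepsilon(\Lambda)\cong\boldsymbol\eta(\Lambda)^{\mathrm{op}}.$$
   Context: A cyclic Nakayama algebra is an algebra $\mathbb{K}Q/I$ over a field $\mathbb{K}$ where $Q$ is an oriented cycle and $I$ is an admissible ideal. Let $\mathcal{S}$ be the set of (isomorphism classes of) simple modules $\operatorname{soc}Q$ and $\mathcal{T}$ the set of simple modules $\operatorname{top}Q$, where $Q$ runs over the indecomposable projective-injective $\Lambda$-modules. Let $\tau$ be the Auslander--Reiten translate and $\tau^-$ its inverse (on simple modules these are mutually inverse cyclic permutations), $P(-)$ projective cover and $I(-)$ injective envelope. Define $$\boldsymbol\varepsilon(\Lambda):=\operatorname{End}_\Lambda\Big(\bigoplus_{S\in\mathcal{S}}P(\tau S)\Big),\qquad \boldsymbol\eta(\Lambda):=\operatorname{End}_\Lambda\Big(\bigoplus_{T\in\mathcal{T}}I(\tau^-T)\Big)^{\mathrm{op}}.$$ *)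

(* Defs.v *)
From HB Require Import structures.
From mathcomp Require Import all_boot all_order all_algebra all_field.
From mathcomp Require Import finmap.
From mathcomp Require Import monalg.

Set Implicit Arguments.
Unset Strict Implicit.
Unset Printing Implicit Defensive.

Import GRing.Theory.

Local Open Scope ring_scope.

(** * Path algebras *)

Record quiver := Quiver {
  vertex : finType;
  arrow : finType;
  source : arrow -> vertex;
  target : arrow -> vertex }.

Section Paths.
Variable Q : quiver.

Fixpoint composable (v : vertex Q) (s : seq (arrow Q)) : bool :=
  if s is a :: s' then (source a == v) && composable (target a) s' else true.

(* The start vertex is recorded so that trivial paths at distinct vertices are
   distinct. *)
Record qpath := QPath {
  qpath_val : vertex Q * seq (arrow Q);
  _ : composable qpath_val.1 qpath_val.2 }.

HB.instance Definition _ := [isSub for qpath_val].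
HB.instance Definition _ := [Choice of qpath by <:].

Definition psource (p : qpath) := (val p).1.
Definition parrows (p : qpath) := (val p).2.
Definition ptarget (p : qpath) :=
  last (psource p) [seq target a | a <- parrows p].

Definition trivial_path (v : vertex Q) : qpath := @QPath (v, [::]) isT.

Lemma arrow_path_subproof (a : arrow Q) : composable (source a) [:: a].
Proof. by rewrite /= eqxx. Qed.
Definition arrow_path (a : arrow Q) : qpath :=
  @QPath (source a, [:: a]) (arrow_path_subproof a).

Lemma composable_cat v s1 s2 : composable v (s1 ++ s2) =
  composable v s1 && composable (last v [seq target a | a <- s1]) s2.
Proof. by elim: s1 v => //= a s1 IH v; rewrite IH andbA. Qed.

Lemma path_cat_subproof (p q : qpath) : ptarget p = psource q ->
  composable (psource p) (parrows p ++ parrows q).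
Proof.
move=> e; rewrite composable_cat (valP p) /=.
by rewrite /ptarget in e; rewrite e (valP q).
Qed.
Definition path_cat (p q : qpath) (e : ptarget p = psource q) : qpath :=
  @QPath (psource p, parrows p ++ parrows q) (path_cat_subproof e).

End Paths.

Definition path_algebra (K : fieldType) (Q : quiver) := {malg K[qpath Q]}.

HB.instance Definition _ K Q := GRing.Lmodule.on (path_algebra K Q).

(* The following operations are locked only to keep unification fast. *)
HB.lock Definition path_elt (K : fieldType) (Q : quiver) (p : qpath Q) :
  path_algebra K Q := << p >>.

(* Paths compose from left to right: p * q is "first p, then q". *)
HB.lock Definition path_mul (K : fieldType) (Q : quiver) (p q : qpath Q) :
    path_algebra K Q :=
  if ptarget p =P psource q is ReflectT e then path_elt K (path_cat e) else 0.

HB.lock Definition pa_mul (K : fieldType) (Q : quiver)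
    (x y : path_algebra K Q) : path_algebra K Q :=
  \sum_(p <- msupp x) \sum_(q <- msupp y) (x@_p * y@_q) *: path_mul K p q.

Section PathAlgebra.
Variables (K : fieldType) (Q : quiver).
Local Notation path_algebra := (path_algebra K Q).
Local Notation path_elt := (@path_elt K Q).
Local Notation path_mul := (@path_mul K Q).
Local Notation pa_mul := (@pa_mul K Q).

Definition pa_one : path_algebra :=
  \sum_(v : vertex Q) path_elt (trivial_path v).

Lemma path_mulE p q (e : ptarget p = psource q) :
  path_mul p q = path_elt (path_cat e).
Proof.
rewrite path_mul.unlock; case: eqP => [e'|/(_ e)//].
by rewrite (eq_irrelevance e' e).
Qed.

Lemma path_mul0 p q : ptarget p != psource q -> path_mul p q = 0.
Proof. by rewrite path_mul.unlock; case: eqP. Qed.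

Lemma pa_mulEw (d1 d2 : {fset qpath Q}) x y :
  (msupp x `<=` d1)%fset -> (msupp y `<=` d2)%fset ->
  pa_mul x y = \sum_(p <- d1) \sum_(q <- d2) (x@_p * y@_q) *: path_mul p q.
Proof.
move=> le1 le2; rewrite pa_mul.unlock (big_fset_incl _ le1) /=; last first.
  by move=> p _ /mcoeff_outdom e; rewrite big1 // => q _; rewrite e mul0r scale0r.
apply: eq_bigr => p _; apply: big_fset_incl => // q _ /mcoeff_outdom ->.
by rewrite mulr0 scale0r.
Qed.

Lemma pa_mulDl : left_distributive pa_mul +%R.
Proof.
move=> x y z; pose d := (msupp x `|` msupp y)%fset.
rewrite (@pa_mulEw d (msupp z)) ?msuppD_le //.
rewrite (@pa_mulEw d (msupp z) x) ?fsubsetUl //.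
rewrite (@pa_mulEw d (msupp z) y) ?fsubsetUr // -big_split /=.
apply: eq_bigr => p _; rewrite -big_split /=; apply: eq_bigr => q _.
by rewrite mcoeffD mulrDl scalerDl.
Qed.

Lemma pa_mulDr : right_distributive pa_mul +%R.
Proof.
move=> z x y; pose d := (msupp x `|` msupp y)%fset.
rewrite (@pa_mulEw (msupp z) d) ?msuppD_le //.
rewrite (@pa_mulEw (msupp z) d z x) ?fsubsetUl //.
rewrite (@pa_mulEw (msupp z) d z y) ?fsubsetUr // -big_split /=.
apply: eq_bigr => p _; rewrite -big_split /=; apply: eq_bigr => q _.
by rewrite mcoeffD mulrDr scalerDl.
Qed.

Lemma pa_mul0l x : pa_mul 0 x = 0.
Proof. by rewrite pa_mul.unlock msupp0 big_seq_fset0. Qed.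

Lemma pa_mul0r x : pa_mul x 0 = 0.
Proof.
by rewrite pa_mul.unlock msupp0 big1 // => p _; rewrite big_seq_fset0.
Qed.

Lemma pa_mulZl c x y : pa_mul (c *: x) y = c *: pa_mul x y.
Proof.
rewrite (pa_mulEw (msuppZ_le c x) (fsubset_refl _)) pa_mul.unlock scaler_sumr.
apply: eq_bigr => p _; rewrite scaler_sumr; apply: eq_bigr => q _.
by rewrite mcoeffZ scalerA mulrA.
Qed.

Lemma pa_mulZr c x y : pa_mul x (c *: y) = c *: pa_mul x y.
Proof.
rewrite (pa_mulEw (fsubset_refl _) (msuppZ_le c y)) pa_mul.unlock scaler_sumr.
apply: eq_bigr => p _; rewrite scaler_sumr; apply: eq_bigr => q _.
by rewrite mcoeffZ scalerA mulrCA.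
Qed.

Lemma pa_mul_elt p q : pa_mul (path_elt p) (path_elt q) = path_mul p q.
Proof.
rewrite {1 2}path_elt.unlock (pa_mulEw msuppU_le msuppU_le) !big_seq_fset1 !mcoeffUU.
by rewrite mulr1 scale1r.
Qed.

Lemma pa_eltE (x : path_algebra) :
  x = \sum_(p <- msupp x) x@_p *: path_elt p.
Proof.
rewrite {1}[x]monalgE; apply: eq_bigr => p _; apply/malgP => q.
rewrite mcoeffU mcoeffZ path_elt.unlock (mcoeffU p 1 q).
by case: (p == q); rewrite ?mulr1n ?mulr0n ?mulr1 ?mulr0.
Qed.

Lemma pa_mul_suml I (r : seq I) (F : I -> path_algebra) y :
  pa_mul (\sum_(i <- r) F i) y = \sum_(i <- r) pa_mul (F i) y.
Proof.
exact: (big_morph (pa_mul^~ y) (fun a b => pa_mulDl a b y) (pa_mul0l y)).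
Qed.

Lemma pa_mul_sumr I (r : seq I) (F : I -> path_algebra) x :
  pa_mul x (\sum_(i <- r) F i) = \sum_(i <- r) pa_mul x (F i).
Proof. exact: (big_morph (pa_mul x) (pa_mulDr x) (pa_mul0r x)). Qed.

Lemma ptarget_cat (p q : qpath Q) (e : ptarget p = psource q) :
  ptarget (path_cat e) = ptarget q.
Proof.
by rewrite /ptarget /psource /parrows /= map_cat last_cat -/(psource q) -e.
Qed.

Lemma path_mulA p q r :
  pa_mul (path_elt p) (pa_mul (path_elt q) (path_elt r)) =
  pa_mul (pa_mul (path_elt p) (path_elt q)) (path_elt r).
Proof.
rewrite (pa_mul_elt p q) (pa_mul_elt q r).
have [e1|n1] := eqVneq (ptarget p) (psource q); last first.
  rewrite (path_mul0 n1) pa_mul0l; have [e2|n2] := eqVneq (ptarget q) (psource r).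
    by rewrite (path_mulE e2) pa_mul_elt path_mul0.
  by rewrite (path_mul0 n2) pa_mul0r.
rewrite (path_mulE e1) pa_mul_elt.
have [e2|n2] := eqVneq (ptarget q) (psource r); last first.
  by rewrite (path_mul0 n2) pa_mul0r path_mul0 // ptarget_cat.
rewrite (path_mulE e2) pa_mul_elt.
have e3 : ptarget p = psource (path_cat e2) by rewrite e1.
have e4 : ptarget (path_cat e1) = psource r by rewrite ptarget_cat.
have -> : path_mul p (path_cat e2) = path_elt (path_cat e3) := path_mulE e3.
rewrite (path_mulE e4); suff -> : path_cat e3 = path_cat e4 by [].
by apply: val_inj; rewrite /= /parrows /= catA.
Qed.

Lemma pa_mulZZ a b (x y : path_algebra) :
  pa_mul (a *: x) (b *: y) = (a * b) *: pa_mul x y.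
Proof. by rewrite pa_mulZl pa_mulZr scalerA. Qed.

Lemma pa_mulZA a b c (x y z : path_algebra) :
  pa_mul x (pa_mul y z) = pa_mul (pa_mul x y) z ->
  pa_mul (a *: x) (pa_mul (b *: y) (c *: z)) =
  pa_mul (pa_mul (a *: x) (b *: y)) (c *: z).
Proof.
move=> e; apply: (etrans (congr1 (pa_mul (a *: x)) (pa_mulZZ b c y z))).
apply: (etrans (pa_mulZZ _ _ _ _)); rewrite e mulrA -pa_mulZZ.
exact: (congr1 (pa_mul^~ (c *: z)) (esym (pa_mulZZ a b x y))).
Qed.

Lemma pa_mulA : associative pa_mul.
Proof.
move=> x y z; rewrite [x]pa_eltE [y]pa_eltE [z]pa_eltE.
rewrite pa_mul_suml [X in _ = pa_mul X _]pa_mul_suml pa_mul_suml.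
apply: eq_bigr => p _.
rewrite [X in pa_mul _ X = _]pa_mul_suml.
rewrite pa_mul_sumr [X in _ = pa_mul X _]pa_mul_sumr pa_mul_suml.
apply: eq_bigr => q _.
rewrite [X in pa_mul _ X = _]pa_mul_sumr [LHS]pa_mul_sumr [RHS]pa_mul_sumr.
apply: eq_bigr => r _.
exact/pa_mulZA/path_mulA.
Qed.

Lemma pa_mul1x : left_id pa_one pa_mul.
Proof.
move=> x; rewrite [x]pa_eltE pa_mul_sumr; apply: eq_bigr => p _.
rewrite pa_mulZr; congr (_ *: _).
rewrite /pa_one pa_mul_suml (bigD1 (psource p)) //= big1 => [|v nv].
  rewrite addr0 pa_mul_elt (@path_mulE (trivial_path (psource p)) p) //=.
  congr path_elt; apply: val_inj; rewrite /= /psource /parrows /=.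
  by case: (val p).
by rewrite pa_mul_elt path_mul0.
Qed.

Lemma pa_mulx1 : right_id pa_one pa_mul.
Proof.
move=> x; rewrite [x]pa_eltE pa_mul_suml; apply: eq_bigr => p _.
rewrite pa_mulZl; congr (_ *: _).
rewrite /pa_one pa_mul_sumr (bigD1 (ptarget p)) //= big1 => [|v nv].
  rewrite addr0 pa_mul_elt (@path_mulE p (trivial_path (ptarget p))) //=.
  congr path_elt; apply: val_inj; rewrite /= /psource /parrows /= cats0.
  by case: (val p).
by rewrite pa_mul_elt path_mul0 // eq_sym.
Qed.

HB.instance Definition _ := GRing.Zmodule_isPzRing.Build path_algebra
  pa_mulA pa_mul1x pa_mulx1 pa_mulDl pa_mulDr.

End PathAlgebra.

(** * Two-sided ideals and admissible ideals *)

Section Ideals.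
Variable R : pzRingType.
Implicit Types (I J X : R -> Prop).

Definition two_sided_ideal I : Prop :=
  [/\ I 0, forall x y, I x -> I y -> I (x + y)
    & forall a x b, I x -> I (a * x * b)].

Definition ideal_gen X : R -> Prop := fun x =>
  forall I, two_sided_ideal I -> (forall y, X y -> I y) -> I x.

Definition ideal_mul I J : R -> Prop :=
  ideal_gen (fun z => exists x y, [/\ I x, J y & z = x * y]).

Definition ideal_pow I m : R -> Prop := iter m (ideal_mul I) (fun=> True).

End Ideals.

Section Nakayama.
Variable K : fieldType.

Definition arrow_ideal (Q : quiver) : path_algebra K Q -> Prop :=
  ideal_gen (fun x => exists a, x = path_elt K (arrow_path a)).

Definition admissible (Q : quiver) (I : path_algebra K Q -> Prop) : Prop :=
  [/\ two_sided_ideal I,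
      forall x, I x -> ideal_pow (@arrow_ideal Q) 2 x
    & exists2 m, (2 <= m)%N & forall x, ideal_pow (@arrow_ideal Q) m x -> I x].

(* The oriented cycle with n.+1 vertices, hence at least one; for n = 0 it is a
   single loop. *)
Definition oriented_cycle (n : nat) : quiver :=
  @Quiver 'I_n.+1 'I_n.+1 id (@ordS n.+1).

(* [A] is presented as KQ/I by a surjective K-algebra morphism with kernel I. *)
Definition cyclic_nakayama (A : falgType K) : Prop :=
  exists n (I : path_algebra K (oriented_cycle n) -> Prop)
    (pi : {rmorphism path_algebra K (oriented_cycle n) -> A}),
    [/\ admissible I, scalable pi, (forall a, exists x, pi x = a)
      & forall x, pi x = 0 <-> I x].

End Nakayama.

(** * Finite-dimensional modules *)

Inductive side := LeftSide | RightSide.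

Definition opp_side s := if s is LeftSide then RightSide else LeftSide.

(* How the product a * b acts: b acts first on a left module, a acts first on
   a right module. *)
Definition side_comp (K : fieldType) (V : vectType K) s (f g : 'End(V)) :
    'End(V) :=
  if s is LeftSide then (f \o g)%VF else (g \o f)%VF.

Lemma side_comp_morph (K : fieldType) (V W : vectType K) s (f g : 'End(V))
    (f' g' : 'End(W)) (h : V -> W) :
  (forall v, h (f v) = f' (h v)) -> (forall v, h (g v) = g' (h v)) ->
  forall v, h (side_comp s f g v) = side_comp s f' g' (h v).
Proof. by move=> hf hg v; case: s; rewrite !comp_lfunE (hf, hg) (hg, hf). Qed.

Lemma side_comp_dual (K : fieldType) (V W : vectType K) s (f g : 'End(V))
    (f' g' : 'End('Hom(V, W))) :
  (forall h, f' h = (h \o f)%VF) -> (forall h, g' h = (h \o g)%VF) ->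
  forall h, (h \o side_comp s f g)%VF = side_comp (opp_side s) f' g' h.
Proof.
by move=> hf hg h; case: s; rewrite comp_lfunE !(hf, hg) comp_lfunA.
Qed.

Section Modules.
Variables (K : fieldType) (A : falgType K).

(* A one-sided module over A.  The library's [lmodType A] cannot be used
   directly, since the carrier already has a K-scaling as its canonical one. *)
Record fdmod (s : side) := FdMod {
  carrier :> vectType K;
  act : {linear A -> 'End(carrier)};
  act1 : act 1 = \1%VF;
  actM : forall a b, act (a * b) = side_comp s (act a) (act b) }.

(** ** Morphisms *)

Section Hom.
Variables (s : side) (M N : fdmod s).

Definition hom_defect (a : A) (f : 'Hom(M, N)) : 'Hom(M, N) :=
  (f \o act M a)%VF - (act N a \o f)%VF.

Lemma hom_defectE a f v :
  hom_defect a f v = f (act M a v) - act N a (f v).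
Proof. by rewrite add_lfunE opp_lfunE !comp_lfunE. Qed.

Fact hom_defect_is_linear a : linear (hom_defect a).
Proof.
move=> k f g; rewrite /hom_defect comp_lfunDl comp_lfunDr -comp_lfunZl -comp_lfunZr.
by rewrite scalerBr opprD addrACA.
Qed.
HB.instance Definition _ a := GRing.isSemilinear.Build K _ _ _ (hom_defect a)
  (GRing.semilinear_linear (hom_defect_is_linear a)).

(* The space Hom_A(M, N); see [homvP]. *)
Definition homv : {vspace 'Hom(M, N)} :=
  (\bigcap_(i < \dim {:A}) lker (linfun (hom_defect (vbasis {:A})`_i)))%VS.

Lemma homvP (f : 'Hom(M, N)) :
  reflect (forall a v, f (act M a v) = act N a (f v)) (f \in homv).
Proof.
apply: (iffP idP) => [fH a v|fH]; last first.
  rewrite memvE; apply/subv_bigcapP => i _; rewrite -memvE memv_ker lfunE /=.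
  by apply/eqP/lfunP => v; rewrite hom_defectE fH subrr zero_lfunE.
have h0 i : hom_defect (vbasis {:A})`_i f = 0 \/ (\dim {:A} <= i)%N.
  have [ge|lt] := leqP (\dim {:A}) i; [by right | left].
  move: fH; rewrite memvE => /subv_bigcapP /(_ (Ordinal lt) isT) /=.
  by rewrite -memvE memv_ker lfunE /= => /eqP.
rewrite (coord_vbasis (memvf a)) !linear_sum /= !sum_lfunE linear_sum.
apply: eq_bigr => i _; rewrite !linearZ /= !scale_lfunE linearZ /=; congr (_ *: _).
case: (h0 i) => [/lfunP /(_ v)|]; last by rewrite leqNgt ltn_ord.
by move/eqP; rewrite hom_defectE zero_lfunE subr_eq0 => /eqP.
Qed.

Definition mod_iso : Prop :=
  exists2 f : 'Hom(M, N), f \in homv & lker f = 0%VS /\ limg f = fullv.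

End Hom.

Definition endv s (M : fdmod s) : {vspace 'End(M)} := homv M M.

(* [E] is isomorphic to the K-algebra End_A(M), with composition as product. *)
Definition is_End_algebra s (M : fdmod s) (E : algType K) : Prop :=
  exists phi : {linear E -> 'End(M)},
    [/\ injective phi, (forall f, f \in endv M <-> exists x, phi x = f),
        phi 1 = \1%VF & forall x y, phi (x * y) = (phi x \o phi y)%VF].

(** ** Constructions *)

Section Zero.
Variable s : side.
Let act (_ : A) : 'End('rV[K]_0) := 0.
Fact mod0_act_is_linear : linear act.
Proof. by move=> k a b; rewrite /act scaler0 addr0. Qed.
HB.instance Definition _ := GRing.isSemilinear.Build K _ _ _ act
  (GRing.semilinear_linear mod0_act_is_linear).
Fact mod0_act1 : act 1 = \1%VF.
Proof. by apply/lfunP => v; rewrite [LHS]thinmx0 [RHS]thinmx0. Qed.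
Fact mod0_actM a b : act (a * b) = side_comp s (act a) (act b).
Proof. by rewrite /act /side_comp; case: s; rewrite comp_lfun0l. Qed.
Definition mod0 : fdmod s := FdMod mod0_act1 mod0_actM.
End Zero.

Section DirectSum.
Variables (s : side) (M N : fdmod s).
Let act_fun (a : A) (u : M * N) : M * N := (act M a u.1, act N a u.2).
Fact mod_sum_act_fun_is_linear a : linear (act_fun a).
Proof. by move=> k u v; rewrite /act_fun !linearP. Qed.
HB.instance Definition _ a := GRing.isSemilinear.Build K _ _ _ (act_fun a)
  (GRing.semilinear_linear (mod_sum_act_fun_is_linear a)).
Let act (a : A) : 'End((M * N)%type) := linfun (act_fun a).
Fact mod_sum_act_is_linear : linear act.
Proof.
move=> k a b; apply/lfunP => u.
by rewrite add_lfunE scale_lfunE !lfunE /= /act_fun !linearP /= !add_lfunE !scale_lfunE.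
Qed.
HB.instance Definition _ := GRing.isSemilinear.Build K _ _ _ act
  (GRing.semilinear_linear mod_sum_act_is_linear).
Fact mod_sum_act1 : act 1 = \1%VF.
Proof.
apply/lfunP => -[u v]; rewrite lfunE /= /act_fun !act1.
by rewrite !id_lfunE.
Qed.
Fact mod_sum_actM a b : act (a * b) = side_comp s (act a) (act b).
Proof.
apply/lfunP => u; rewrite lfunE /= /act_fun !actM [RHS]surjective_pairing.
congr pair; apply/esym.
- by apply: (@side_comp_morph K _ _ s _ _ _ _ (fun w => w.1)) => v; rewrite lfunE.
- by apply: (@side_comp_morph K _ _ s _ _ _ _ (fun w => w.2)) => v; rewrite lfunE.
Qed.
Definition mod_sum : fdmod s := FdMod mod_sum_act1 mod_sum_actM.
End DirectSum.

Definition mod_bigsum s k (M : 'I_k -> fdmod s) : fdmod s :=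
  \big[@mod_sum s / mod0 s]_(i < k) M i.

(* A as a module over itself: left, resp. right, multiplication. *)
Section Regular.
Variable s : side.
Definition reg_act : {linear A -> 'End(A)} :=
  if s is LeftSide then amull (aT := A) else amulr (aT := A).
Fact reg_act1 : reg_act 1 = \1%VF.
Proof. by apply/lfunP => x; rewrite /reg_act; case: s; rewrite !lfunE /= ?mul1r ?mulr1. Qed.
Fact reg_actM a b : reg_act (a * b) = side_comp s (reg_act a) (reg_act b).
Proof.
by apply/lfunP => x; rewrite /reg_act /side_comp; case: s; rewrite comp_lfunE !lfunE /= mulrA.
Qed.
Definition regular : fdmod s := FdMod reg_act1 reg_actM.
End Regular.

(* The standard duality D = Hom_K(-, K), exchanging left and right modules. *)
Section Dual.
Variables (s : side) (M : fdmod s).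
Let act_fun (a : A) (f : 'Hom(M, K^o)) : 'Hom(M, K^o) := (f \o act M a)%VF.
Fact dual_act_fun_is_linear a : linear (act_fun a).
Proof. by move=> k f g; rewrite /act_fun comp_lfunDl comp_lfunZl. Qed.
HB.instance Definition _ a := GRing.isSemilinear.Build K _ _ _ (act_fun a)
  (GRing.semilinear_linear (dual_act_fun_is_linear a)).
Let act (a : A) : 'End('Hom(M, K^o)) := linfun (act_fun a).
Fact dual_act_is_linear : linear act.
Proof.
move=> k a b; apply/lfunP => f.
by rewrite add_lfunE scale_lfunE !lfunE /= /act_fun linearP comp_lfunDr comp_lfunZr.
Qed.
HB.instance Definition _ := GRing.isSemilinear.Build K _ _ _ act
  (GRing.semilinear_linear dual_act_is_linear).
Fact dual_act1 : act 1 = \1%VF.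
Proof.
by apply/lfunP => f; rewrite lfunE /= /act_fun act1 comp_lfun1r id_lfunE.
Qed.
Fact dual_actM a b : act (a * b) = side_comp (opp_side s) (act a) (act b).
Proof.
apply/lfunP => f; rewrite lfunE /= /act_fun actM.
by apply: side_comp_dual => h; rewrite lfunE.
Qed.
Definition dual : fdmod (opp_side s) := FdMod dual_act1 dual_actM.
End Dual.

(* The A-dual Hom_A(M, A), a module on the other side through the remaining
   multiplication of A. *)
Section Star.
Variables (s : side) (M : fdmod s).
Let car := subvs_of (homv M (regular s)).
Let act_fun (a : A) (f : car) : car :=
  vsproj (homv M (regular s)) (act (regular (opp_side s)) a \o vsval f)%VF.
Lemma reg_act_comm a b x :
  act (regular (opp_side s)) a (act (regular s) b x) =
  act (regular s) b (act (regular (opp_side s)) a x).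
Proof. by rewrite /= /reg_act; case: s; rewrite !lfunE /= mulrA. Qed.
Lemma star_act_closed a (f : car) :
  (act (regular (opp_side s)) a \o vsval f)%VF \in homv M (regular s).
Proof.
apply/homvP => b v; rewrite !comp_lfunE.
have /homvP -> := valP f.
exact: reg_act_comm.
Qed.
Lemma star_actE a f : vsval (act_fun a f) =
  (act (regular (opp_side s)) a \o vsval f)%VF.
Proof. by rewrite vsprojK ?star_act_closed. Qed.
Fact star_act_fun_is_linear a : linear (act_fun a).
Proof.
move=> k f g; rewrite /act_fun linearP /= comp_lfunDr -comp_lfunZr.
by rewrite linearP.
Qed.
HB.instance Definition _ a := GRing.isSemilinear.Build K _ _ _ (act_fun a)
  (GRing.semilinear_linear (star_act_fun_is_linear a)).
Let act (a : A) : 'End(car) := linfun (act_fun a).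
Fact star_act_is_linear : linear act.
Proof.
move=> k a b; apply/lfunP => f; rewrite add_lfunE scale_lfunE !lfunE /=.
by rewrite /act_fun linearP comp_lfunDl -comp_lfunZl linearP.
Qed.
HB.instance Definition _ := GRing.isSemilinear.Build K _ _ _ act
  (GRing.semilinear_linear star_act_is_linear).
Fact star_act1 : act 1 = \1%VF.
Proof.
apply/lfunP => f; apply: val_inj; rewrite lfunE /= star_actE id_lfunE.
by rewrite (act1 (regular _)) comp_lfun1l.
Qed.
Fact star_actM a b : act (a * b) = side_comp (opp_side s) (act a) (act b).
Proof.
apply/lfunP => f; apply: val_inj; apply/lfunP => v.
rewrite lfunE /= star_actE comp_lfunE (actM (regular _)).
symmetry; apply: (@side_comp_morph K _ _ _ _ _ _ _ (fun g : car => vsval g v)) => g.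
- by rewrite lfunE /= star_actE comp_lfunE.
- by rewrite lfunE /= star_actE comp_lfunE.
Qed.
Definition star : fdmod (opp_side s) := FdMod star_act1 star_actM.
End Star.

(** ** Submodules, socle and top *)

Section Submodules.
Variables (s : side) (M : fdmod s).
Implicit Types U V W : {vspace M}.

Definition submodule U : Prop := forall a v, v \in U -> act M a v \in U.

Definition simple_submodule W : Prop :=
  [/\ submodule W, W != 0%VS
    & forall U, submodule U -> (U <= W)%VS -> U = 0%VS \/ U = W].

Definition maximal_submodule W : Prop :=
  [/\ submodule W, W != fullv
    & forall U, submodule U -> (W <= U)%VS -> U = W \/ U = fullv].

(* The socle is the sum of the simple submodules. *)
Definition is_socle U : Prop :=
  (forall W, simple_submodule W -> (W <= U)%VS) /\
  (forall V, (forall W, simple_submodule W -> (W <= V)%VS) -> (U <= V)%VS).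

(* The radical is the intersection of the maximal submodules. *)
Definition is_radical U : Prop :=
  forall v, v \in U <-> forall W, maximal_submodule W -> v \in W.

Definition indecomposable : Prop :=
  (fullv : {vspace M}) != 0%VS /\
  forall U V, submodule U -> submodule V ->
    (U + V)%VS = fullv -> (U :&: V)%VS = 0%VS -> U = 0%VS \/ V = 0%VS.

Definition superfluous U : Prop :=
  forall V, submodule V -> (U + V)%VS = fullv -> V = fullv.

Definition essential U : Prop :=
  forall V, submodule V -> (U :&: V)%VS = 0%VS -> V = 0%VS.

End Submodules.

(* [S] is isomorphic to soc Q. *)
Definition is_soc s (Q S : fdmod s) : Prop :=
  exists i : 'Hom(S, Q), [/\ i \in homv S Q, lker i = 0%VS & is_socle (limg i)].

(* [T] is isomorphic to top Q = Q / rad Q. *)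
Definition is_top s (Q T : fdmod s) : Prop :=
  exists p : 'Hom(Q, T),
    [/\ p \in homv Q T, limg p = fullv & is_radical (lker p)].

(** ** Projective and injective modules *)

Definition projective s (P : fdmod s) : Prop :=
  forall (M N : fdmod s) (g : 'Hom(M, N)) (h : 'Hom(P, N)),
    g \in homv M N -> limg g = fullv -> h \in homv P N ->
    exists2 k : 'Hom(P, M), k \in homv P M & (g \o k)%VF = h.

Definition injective_module s (I : fdmod s) : Prop :=
  forall (M N : fdmod s) (g : 'Hom(M, N)) (h : 'Hom(M, I)),
    g \in homv M N -> lker g = 0%VS -> h \in homv M I ->
    exists2 k : 'Hom(N, I), k \in homv N I & (k \o g)%VF = h.

Definition is_proj_cover s (M P : fdmod s) : Prop :=
  projective P /\ exists p : 'Hom(P, M),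
    [/\ p \in homv P M, limg p = fullv & superfluous (lker p)].

Definition is_inj_envelope s (M I : fdmod s) : Prop :=
  injective_module I /\ exists i : 'Hom(M, I),
    [/\ i \in homv M I, lker i = 0%VS & essential (limg i)].

(** ** The Auslander-Reiten translate *)

(* P1 --p1--> P0 --p0--> M --> 0 *)
Definition min_proj_presentation s (P1 P0 M : fdmod s)
    (p1 : 'Hom(P1, P0)) (p0 : 'Hom(P0, M)) : Prop :=
  [/\ projective P1 /\ projective P0, p1 \in homv P1 P0 /\ p0 \in homv P0 M,
      limg p0 = fullv, limg p1 = lker p0
    & superfluous (lker p0) /\ superfluous (lker p1)].

(* [N] is isomorphic to the transpose Tr M, the cokernel of
   Hom_A(p1, A) : Hom_A(P0, A) -> Hom_A(P1, A). *)
Definition is_transpose s (M : fdmod s) (N : fdmod (opp_side s)) : Prop :=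
  exists (P1 P0 : fdmod s) (p1 : 'Hom(P1, P0)) (p0 : 'Hom(P0, M)),
    min_proj_presentation p1 p0 /\
    exists q : 'Hom(star P1, N),
      [/\ q \in homv (star P1) N, limg q = fullv
        & forall f : star P1,
            q f = 0 <-> exists g : star P0, vsval f = (vsval g \o p1)%VF].

(* tau = D Tr and its inverse Tr D. *)
Definition is_tau (M X : fdmod RightSide) : Prop :=
  exists2 N : fdmod LeftSide, is_transpose M N & mod_iso X (dual N).

Definition is_tau_inv (M X : fdmod RightSide) : Prop := is_transpose (dual M) X.

(** ** Syzygy and cosyzygy filtered algebras *)

(* Modules are finite-dimensional right modules. *)

(* [M] lists, without repetition, representatives of the isomorphism classes of
   the modules satisfying [C]. *)
Definition class_representatives s (C : fdmod s -> Prop) k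
    (M : 'I_k -> fdmod s) : Prop :=
  [/\ forall i, C (M i), forall i j, mod_iso (M i) (M j) -> i = j
    & forall N, C N -> exists i, mod_iso N (M i)].

Definition indec_proj_inj s (Q : fdmod s) : Prop :=
  [/\ indecomposable Q, projective Q & injective_module Q].

(* The isomorphism class of [S] belongs to the set of the soc Q. *)
Definition soc_of_proj_inj (S : fdmod RightSide) : Prop :=
  exists2 Q, indec_proj_inj Q & is_soc Q S.

(* The isomorphism class of [T] belongs to the set of the top Q. *)
Definition top_of_proj_inj (T : fdmod RightSide) : Prop :=
  exists2 Q, indec_proj_inj Q & is_top Q T.

(* [E] is isomorphic to epsilon(A) = End_A(sum of the P(tau S)). *)
Definition is_syzygy_filtered_algebra (E : algType K) : Prop :=
  exists k (S tauS P : 'I_k -> fdmod RightSide),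
    [/\ class_representatives soc_of_proj_inj S,
        forall i, is_tau (S i) (tauS i),
        forall i, is_proj_cover (tauS i) (P i)
      & is_End_algebra (mod_bigsum P) E].

End Modules.

(** * Opposite algebras *)

(* The library gives the converse R^c of a ring its ring structure only. *)
HB.instance Definition _ (R : pzSemiRingType) (V : lSemiModType R) :=
  GRing.Nmodule_isLSemiModule.Build R V^c (@scalerA R V) (@scale0r R V)
    (@scale1r R V) (@scalerDr R V) (fun v a b => scalerDl v a b).

Section OppositeAlgebra.
Variables (R : pzRingType) (E : algType R).

Fact converse_scalerAl (k : R) (x y : E^c) : k *: (x * y) = (k *: x) * y.
Proof. exact: (@scalerAr R E k y x). Qed.
HB.instance Definition _ :=
  GRing.Lmodule_isLalgebra.Build R E^c converse_scalerAl.

Fact converse_scalerAr (k : R) (x y : E^c) : k *: (x * y) = x * (k *: y).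
Proof. exact: (@scalerAl R E k y x). Qed.
HB.instance Definition _ :=
  GRing.Lalgebra_isAlgebra.Build R E^c converse_scalerAr.

End OppositeAlgebra.

(* [H] is isomorphic to eta(A) = End_A(sum of the I(tau^- T))^op. *)
Definition is_cosyzygy_filtered_algebra (K : fieldType) (A : falgType K)
    (H : algType K) : Prop :=
  exists k (T tauinvT I : 'I_k -> fdmod A RightSide),
    [/\ class_representatives (@top_of_proj_inj K A) T,
        forall i, is_tau_inv (T i) (tauinvT i),
        forall i, is_inj_envelope (tauinvT i) (I i)
      & is_End_algebra (mod_bigsum I) H^c].

Definition algebra_iso (K : fieldType) (E F : algType K) : Prop :=
  exists phi : {lrmorphism E -> F}, bijective phi.

(* Main.v *)
(* Let e_v be the vertex idempotents, sigma the rotation of the cycle and alpha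
   the sum of the arrows: A has the nonzero e_v alpha^l as a basis, and a module
   M has radical M alpha and socle ker alpha.  Let c(v), d(v) be the least
   exponents with e_v alpha^c(v) = 0 and alpha^d(v) e_v = 0, and put
   h(v) = sigma^c(v) v, g(v) = sigma^-d(v) v.  On the universal cover of the
   cycle these form a Galois connection: h(x) <= y iff x <= g(y).
   The tau S, S in the set of socles, are the simple modules at the vertices in
   im h, and the tau^- T, T in the set of tops, those at the vertices in im g.
   Hence epsilon(A) = e'Ae' and eta(A)^op = eAe, where e' and e are the sums of
   the e_v over im h and im g; for eta one uses that the injective envelope of
   the simple module at v is dual to the left module A e_v.  Now g and h restrict
   to inverse bijections between im h and im g, and a path v -> w between
   vertices of im h is nonzero iff the path g(v) -> g(w) is, so that sending the
   former to the latter is an isomorphism e'Ae' -> eAe. *)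

From HB Require Import structures.
From mathcomp Require Import all_boot all_order all_algebra all_field.
From mathcomp Require Import finmap monalg zify.
Require Import Defs.

Set Implicit Arguments.
Unset Strict Implicit.
Unset Printing Implicit Defensive.

Import GRing.Theory.

Local Open Scope ring_scope.

(** * Duality of vector spaces *)

Section LinearAlgebra.
Variable K : fieldType.
Implicit Types V W : vectType K.

(** The modules in the definitions are given only up to isomorphism, so each is recognised through a
    single vector: [free_on] does this for [e A], [simple_at] for a simple module. An injective
    module is recognised through its dual, by a functional that vanishes on no nonzero submodule.
    The translate of a simple module is simple because no arrow vanishes in [A], the ideal being
    inside the square of the arrow ideal. The minimal presentation of the simple module at [v] is
    then e_(sigma v) A -> e_v A, and Hom(-, A) turns it into right multiplication by [alpha], A e_v
    -> A e_(sigma v), whose cokernel is the top of A e_(sigma v). The images of h and g enter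
    because e_v A is injective exactly when the longest nonzero path from [v] cannot be prolonged
    backwards. The corners are compared by linear maps on all of [A], defined on the basis of
    nonzero paths and zero on paths that leave the corner. The length of a shifted path is a
    difference of natural numbers; that it is a true difference is the monotonicity of g and h on
    the universal cover. *)

Definition dual_basis V (i : 'I_(\dim (fullv : {vspace V}))) : 'Hom(V, K^o) :=
  linfun (coord (vbasis (fullv : {vspace V})) i : V -> K^o).

Lemma dual_basis_expansion V (f : 'Hom(V, K^o)) :
  f = \sum_(i < \dim (fullv : {vspace V})) f (vbasis fullv)`_i *: dual_basis i.
Proof.
apply/lfunP => v; rewrite {1}(coord_vbasis (memvf v)) linear_sum sum_lfunE /=.
apply: eq_bigr => i _; rewrite linearZ scale_lfunE lfunE /=.
exact: mulrC.
Qed.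

(** The coordinates of [f x] are the values at [x] of the images of the dual basis. This turns an
    endomorphism of a dual module back into one of the module itself. *)
Lemma adjoint_map V W (F : 'Hom('Hom(W, K^o), 'Hom(V, K^o))) :
  exists f : 'Hom(V, W), forall (psi : 'Hom(W, K^o)) (x : V), psi (f x) = F psi x.
Proof.
pose f (x : V) : W := \sum_(i < \dim (fullv : {vspace W}))
  (F (dual_basis i) x : K) *: (vbasis (fullv : {vspace W}))`_i.
have lin : linear f.
  move=> k x y; rewrite /f scaler_sumr -big_split; apply: eq_bigr => i _ /=.
  by rewrite linearP scalerDl scalerA.
pose L : {linear V -> W} := HB.pack f (GRing.isLinear.Build _ _ _ _ f lin).
exists (linfun L) => psi x; rewrite lfunE /= /f linear_sum /=.
rewrite {2}(dual_basis_expansion psi) linear_sum sum_lfunE; apply: eq_bigr => i _.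
by rewrite !linearZ scale_lfunE /=; exact: mulrC.
Qed.

(** Reflexivity in finite dimension; it later produces elements of a module, or of [A], from
    functionals on a dual. *)
Lemma bidual_eval V (Omega : 'Hom('Hom(V, K^o), K^o)) :
  exists x : V, forall f : 'Hom(V, K^o), f x = Omega f.
Proof.
exists (\sum_(i < \dim (fullv : {vspace V}))
  (Omega (dual_basis i) : K) *: (vbasis (fullv : {vspace V}))`_i).
move=> f; rewrite {2}(dual_basis_expansion f) !linear_sum; apply: eq_bigr => i _.
by rewrite !linearZ /=; exact: mulrC.
Qed.

Lemma separating_functional V (U : {vspace V}) x : x \notin U ->
  exists f : 'Hom(V, K^o), f x = 1 /\ forall y, y \in U -> f y = 0.
Proof.
move=> xU; pose p := (\1 - projv U)%VF.
have px0 : p x != 0.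
  apply: contra xU; rewrite add_lfunE opp_lfunE id_lfunE subr_eq0 => /eqP ->.
  exact: memv_proj.
(* [p] kills [U] but not [x]; the functional is the coordinate of [p y] along [p x]. *)
pose f : 'Hom(V, K^o) := (linfun (coord [tuple p x] ord0 : V -> K^o) \o p)%VF.
exists f; split=> [|y yU]; rewrite comp_lfunE lfunE /=.
  by rewrite -[p x in X in coord _ _ X]/([tuple p x]`_(@ord0 0)) coord_free ?seq1_free.
have -> : p y = 0 by rewrite add_lfunE opp_lfunE id_lfunE projv_id // subrr.
by rewrite linear0.
Qed.

Lemma dual_coord V (x : V) : x != 0 -> exists f : 'Hom(V, K^o), f x = 1.
Proof. by rewrite -memv0 => /separating_functional [f [fx _]]; exists f. Qed.

Lemma functional_extension V W (g : 'Hom(V, W)) (f : 'Hom(V, K^o)) :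
  lker g = 0%VS -> exists h : 'Hom(W, K^o), forall x, h (g x) = f x.
Proof.
move=> /eqP g0; exists (f \o g^-1)%VF => x.
by rewrite comp_lfunE lker0_lfunK.
Qed.

(** A functional outside [U] would be separated from [U] by an element of the bidual, that is by a
    vector, and the hypothesis makes this vector zero. *)
Lemma annihilator_full V (U : {vspace 'Hom(V, K^o)}) :
  (forall x : V, (forall f, f \in U -> f x = 0) -> x = 0) -> U = fullv.
Proof.
move=> U0; apply/vspaceP => f; rewrite memvf.
apply/negPn/negP => /separating_functional [Om [Omf OmU]].
have [x xE] := bidual_eval Om.
have x0 : x = 0 by apply: U0 => h hU; rewrite xE OmU.
have := xE f; rewrite x0 linear0 Omf => /eqP.
by rewrite eq_sym oner_eq0.
Qed.

Lemma rank_one_map V W (f : 'Hom(V, K^o)) (x : W) :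
  exists g : 'Hom(V, W), forall y, g y = f y *: x.
Proof.
have lin : linear (fun y => f y *: x : W).
  by move=> k y z; rewrite linearP scalerDl scalerA.
pose L : {linear V -> W} := HB.pack (fun y => f y *: x : W)
  (GRing.isLinear.Build _ _ _ _ (fun y => f y *: x : W) lin).
by exists (linfun L) => y; rewrite lfunE.
Qed.

End LinearAlgebra.

(** * Free modules over idempotents *)

Section Modules.
Variables (K : fieldType) (A : falgType K).
Implicit Types (s : side) (a b : A).

(* The product of [A] for which modules on the side [s] are right modules. *)
Definition smul s a b : A := if s is LeftSide then b * a else a * b.

Lemma act_regular s a b : act (regular A s) b a = smul s a b.
Proof. by case: s; rewrite /= lfunE. Qed.

Lemma act_smul s (M : fdmod A s) a b (x : M) :
  act M (smul s a b) x = act M b (act M a x).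
Proof. by case: s M x => M x; rewrite actM comp_lfunE. Qed.

Lemma act1E s (M : fdmod A s) (x : M) : act M 1 x = x.
Proof. by rewrite act1 id_lfunE. Qed.

Lemma actDE s (M : fdmod A s) a b (x : M) : act M (a + b) x = act M a x + act M b x.
Proof. by rewrite linearD add_lfunE. Qed.

Lemma actBE s (M : fdmod A s) a b (x : M) : act M (a - b) x = act M a x - act M b x.
Proof. by rewrite linearB add_lfunE opp_lfunE. Qed.

Lemma actZE s (M : fdmod A s) k a (x : M) : act M (k *: a) x = k *: act M a x.
Proof. by rewrite linearZ scale_lfunE. Qed.

Lemma act0E s (M : fdmod A s) (x : M) : act M 0 x = 0.
Proof. by rewrite linear0 zero_lfunE. Qed.

Lemma smulA s : associative (smul s).
Proof. by case: s => a b c; rewrite /= mulrA. Qed.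
Lemma smul1r s a : smul s 1 a = a.
Proof. by case: s; rewrite /= ?mul1r ?mulr1. Qed.
Lemma smulr1 s a : smul s a 1 = a.
Proof. by case: s; rewrite /= ?mul1r ?mulr1. Qed.
Lemma smulDl s a b c : smul s (a + b) c = smul s a c + smul s b c.
Proof. by case: s; rewrite /= ?mulrDl ?mulrDr. Qed.
Lemma smulDr s a b c : smul s c (a + b) = smul s c a + smul s c b.
Proof. by case: s; rewrite /= ?mulrDl ?mulrDr. Qed.
Lemma smulZl s k a b : smul s (k *: a) b = k *: smul s a b.
Proof. by case: s; rewrite /= -?scalerAl -?scalerAr. Qed.
Lemma smulZr s k a b : smul s a (k *: b) = k *: smul s a b.
Proof. by case: s; rewrite /= -?scalerAl -?scalerAr. Qed.
Lemma smul0r s a : smul s 0 a = 0.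
Proof. by case: s; rewrite /= ?mul0r ?mulr0. Qed.
Lemma smulr0 s a : smul s a 0 = 0.
Proof. by case: s; rewrite /= ?mul0r ?mulr0. Qed.
Lemma smulNl s a b : smul s (- a) b = - smul s a b.
Proof. by rewrite -!scaleN1r smulZl. Qed.
Lemma smulNr s a b : smul s a (- b) = - smul s a b.
Proof. by rewrite -!scaleN1r smulZr. Qed.
Lemma smul_opp s a b : smul (opp_side s) a b = smul s b a.
Proof. by case: s. Qed.
Lemma smul_exprS s a l : smul s a (a ^+ l) = a ^+ l.+1.
Proof. by case: s; rewrite /= -?exprS -?exprSr. Qed.
Lemma smul_exprSr s a l : smul s (a ^+ l) a = a ^+ l.+1.
Proof. by case: s; rewrite /= -?exprS -?exprSr. Qed.
Lemma smul_exprD s a k l : smul s (a ^+ k) (a ^+ l) = a ^+ (k + l).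
Proof. by case: s; rewrite /= -?exprD 1?addnC. Qed.

Lemma act_exprS s (M : fdmod A s) a l (x : M) :
  act M (a ^+ l.+1) x = act M a (act M (a ^+ l) x).
Proof. by rewrite -(smul_exprSr s) act_smul. Qed.

Definition orb s (M : fdmod A s) (x : M) (a : A) : M := act M a x.
Fact orb_is_linear s (M : fdmod A s) (x : M) : linear (orb x).
Proof. by move=> k a b; rewrite /orb actDE actZE. Qed.
HB.instance Definition _ s (M : fdmod A s) (x : M) :=
  GRing.isSemilinear.Build K _ _ _ (orb x) (GRing.semilinear_linear (orb_is_linear x)).

Definition orbit_map s (M : fdmod A s) (x : M) : 'Hom(A, M) := linfun (orb x).

Lemma orbit_mapE s (M : fdmod A s) (x : M) a : orbit_map x a = act M a x.
Proof. by rewrite lfunE. Qed.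

Lemma orbit_map_hom s (M : fdmod A s) (x : M) :
  (orbit_map x : 'Hom(regular A s, M)) \in homv (regular A s) M.
Proof.
apply/homvP => a b; rewrite (act_regular s b a) orbit_mapE act_smul.
by rewrite orbit_mapE.
Qed.

(* [x] generates [M] freely over the idempotent [e], i.e. M ~ eA via ea |-> x a. *)
Definition free_on s (M : fdmod A s) (e : A) (x : M) : Prop :=
  [/\ act M e x = x, forall y, exists a, y = act M a x
    & forall a, act M a x = 0 -> smul s e a = 0].

Lemma free_lift s (P M : fdmod A s) e (u : P) (x : M) :
  free_on e u -> act M e x = x -> exists2 f : 'Hom(P, M), f \in homv P M & f u = x.
Proof.
move=> [ue gen ann] xe; pose f : 'Hom(P, M) := (orbit_map x \o (orbit_map u)^-1)%VF.
have fE a : f (act P a u) = act M a x.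
  (* [c] is a linear choice of a coefficient. It may differ from [a], but [e (c - a) = 0], and this
     kills [x = x e]. *)
  rewrite comp_lfunE orbit_mapE; set c := (_^-1)%VF _.
  have cE : act P c u = act P a u.
    by rewrite -orbit_mapE limg_lfunVK // -orbit_mapE memv_img ?memvf.
  have : act P (c - a) u = 0 by rewrite actBE cE subrr.
  move/ann => c0; apply/eqP; rewrite -subr_eq0 -actBE -xe -act_smul.
  by rewrite c0 act0E.
exists f; last by rewrite -[u in LHS]act1E fE act1E.
apply/homvP => a y; have [b ->] := gen y.
by rewrite -act_smul !fE act_smul.
Qed.

Lemma free_hom_ext s (P M : fdmod A s) e (u : P) (f g : 'Hom(P, M)) :
  free_on e u -> f \in homv P M -> g \in homv P M -> f u = g u -> f = g.
Proof.
move=> [_ gen _] /homvP fH /homvP gH fg; apply/lfunP => x.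
by have [a ->] := gen x; rewrite fH gH fg.
Qed.

(** The element [e - 1] kills the generator, hence [e (e - 1) = 0]. *)
Lemma free_idempotent s (P : fdmod A s) e (u : P) : free_on e u -> smul s e e = e.
Proof.
move=> [ue _ ann]; have := ann (e - 1); rewrite actBE act1E ue subrr => /(_ erefl).
by rewrite smulDr smulNr smulr1 => /eqP; rewrite subr_eq0 => /eqP.
Qed.

Lemma comp_homv s (M N P : fdmod A s) (g : 'Hom(N, P)) (f : 'Hom(M, N)) :
  g \in homv N P -> f \in homv M N -> (g \o f)%VF \in homv M P.
Proof.
by move=> /homvP gH /homvP fH; apply/homvP => a x; rewrite !comp_lfunE fH gH.
Qed.

Lemma free_projective s (P : fdmod A s) e (u : P) : free_on e u -> projective P.
Proof.
move=> fP M N g h gH gS hH; have [ue _ _] := fP; have ee := free_idempotent fP.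
have : h u \in limg g by rewrite gS memvf.
case/memv_imgP => y _ yE.
(* Any preimage of [h u] will do once it is cut down by [e]. *)
have [|k kH ku] := @free_lift _ P M e u (act M e y) fP; first by rewrite -act_smul ee.
exists k => //; apply: (free_hom_ext fP (comp_homv gH kH) hH).
rewrite comp_lfunE ku; move/homvP: gH => ->.
by rewrite -yE; move/homvP: hH => <-; rewrite ue.
Qed.

End Modules.

(** * Vertices, arrows and projective covers *)

(* A family of vertex idempotents [e], permuted by [sigma] as the arrows go, and
   the sum [alpha] of all arrows.  The axioms are stable under exchanging the
   sides and inverting [sigma], see [nakayama_opp]. *)
Record nakayama (K : fieldType) (A : falgType K) (s : side) (V : finType)
    (e : V -> A) (sigma sigma' : V -> V) (alpha : A) (m : nat) : Prop := Nakayama {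
  nk_idem : forall v w, smul s (e v) (e w) = if v == w then e v else 0;
  nk_sum : \sum_v e v = 1;
  nk_comm : forall v, smul s (e v) alpha = smul s alpha (e (sigma v));
  nk_K : cancel sigma sigma';
  nk_K' : cancel sigma' sigma;
  nk_nil : alpha ^+ m = 0;
  nk_nz : forall v, smul s (e v) alpha != 0;
  nk_ind : forall P : A -> Prop, P 0 ->
    (forall k a b, P a -> P b -> P (k *: a + b)) ->
    (forall v l, P (smul s (e v) (alpha ^+ l))) -> forall a, P a }.

Section Nakayama.
Variables (K : fieldType) (A : falgType K).

Section Datum.
Variables (s : side) (V : finType) (e : V -> A) (sigma sigma' : V -> V).
Variables (alpha : A) (m : nat).
Hypothesis nkD : nakayama s e sigma sigma' alpha m.
Local Notation "a ** b" := (smul s a b) (at level 40, left associativity).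
Implicit Types (M N P : fdmod A s) (a b : A) (v w : V).

Lemma nk_idem1 v : e v ** e v = e v.
Proof. by rewrite (nk_idem nkD) eqxx. Qed.

Lemma nk_pow v l : e v ** alpha ^+ l = alpha ^+ l ** e (iter l sigma v).
Proof.
elim: l => [|l IH]; first by rewrite expr0 smulr1 smul1r.
by rewrite -(smul_exprSr s) smulA IH -smulA (nk_comm nkD) smulA.
Qed.

Lemma nakayama_opp : nakayama (opp_side s) e sigma' sigma alpha m.
Proof.
have H v l : alpha ^+ l ** e v = e (iter l sigma' v) ** alpha ^+ l.
  rewrite nk_pow; congr (_ ** e _).
  elim: l v => [//|l IH] v; rewrite iterSr.
  by rewrite -[iter l.+1 _ v]/(sigma' (iter l sigma' v)) (nk_K' nkD).
split.
- move=> v w; rewrite smul_opp (nk_idem nkD) eq_sym.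
  by case: eqP => // ->.
- exact: nk_sum nkD.
- by move=> v; rewrite !smul_opp; have := H v 1%N; rewrite expr1.
- exact: nk_K' nkD.
- exact: nk_K nkD.
- exact: nk_nil nkD.
- move=> v; rewrite smul_opp; have := H v 1%N; rewrite expr1 => ->.
  exact: (nk_nz nkD (sigma' v)).
- move=> P P0 Plin Pgen; apply: (nk_ind nkD) => // v l.
  by rewrite nk_pow -smul_opp.
Qed.

(** Moving a power of [alpha] across a path only rotates the vertex, so [alpha] is a normal element.
    For this reason the image and the kernel of [alpha] are submodules of every module. *)
Lemma nk_normal a l : exists b, a ** alpha ^+ l = alpha ^+ l ** b.
Proof.
elim/(nk_ind nkD): a => [|k a b [a' aE] [b' bE]|v j].
- by exists 0; rewrite smul0r smulr0.
- by exists (k *: a' + b'); rewrite smulDl smulZl aE bE smulDr smulZr.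
- exists (e (iter l sigma v) ** alpha ^+ j).
  by rewrite smulA -nk_pow -!smulA !smul_exprD addnC.
Qed.

(** Modulo [A alpha] the module [e v A] is spanned by [e v]: it is local with one-dimensional
    top. *)
Lemma nk_local a v : exists k b, e v ** a = k *: e v + b ** alpha.
Proof.
elim/(nk_ind nkD): a => [|k a b [ka [a' aE]] [kb [b' bE]]|w [|l]].
- by exists 0, 0; rewrite smulr0 smul0r scale0r addr0.
- exists (k * ka + kb), (k *: a' + b').
  rewrite smulDr smulZr aE bE smulDl smulZl scalerDr scalerA scalerDl.
  by rewrite addrACA.
- exists (v == w)%:R, 0; rewrite expr0 smulr1 smul0r addr0 (nk_idem nkD).
  by case: eqP; rewrite ?scale1r ?scale0r.
- exists 0, (e v ** e w ** alpha ^+ l).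
  by rewrite scale0r add0r -!smulA smul_exprSr.
Qed.

End Datum.

Section Modules.
Variables (s : side) (V : finType) (e : V -> A) (sigma sigma' : V -> V).
Variables (alpha : A) (m : nat).
Hypothesis nkD : nakayama s e sigma sigma' alpha m.
Local Notation "a ** b" := (smul s a b) (at level 40, left associativity).
Implicit Types (M N P : fdmod A s) (a b : A) (v w : V).

Let nkO := nakayama_opp nkD.

Lemma nk_normal' a l : exists b, alpha ^+ l ** a = b ** alpha ^+ l.
Proof. by have [b] := nk_normal nkO a l; rewrite !smul_opp => E; exists b. Qed.

Lemma nk_local' a v : exists k b, a ** e v = k *: e v + b ** alpha.
Proof.
have [k [b]] := nk_local nkO a v; rewrite !smul_opp => ->.
by have := nk_normal' b 1; rewrite expr1 => -[c ->]; exists k, c.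
Qed.

Lemma act_nil M (x : M) : act M (alpha ^+ m) x = 0.
Proof. by rewrite (nk_nil nkD) act0E. Qed.

Lemma act_alphaC M a (x : M) :
  exists b, act M a (act M alpha x) = act M alpha (act M b x).
Proof.
have := nk_normal' a 1; rewrite expr1 => -[b E]; exists b.
by rewrite -!act_smul E.
Qed.

Lemma act_alphaC' M a (x : M) :
  exists b, act M alpha (act M a x) = act M b (act M alpha x).
Proof.
have := nk_normal nkD a 1; rewrite expr1 => -[b E]; exists b.
by rewrite -!act_smul E.
Qed.

Lemma act_sum M (x : M) : x = \sum_v act M (e v) x.
Proof. by rewrite -{1}[x]act1E -(nk_sum nkD) linear_sum sum_lfunE. Qed.

Lemma hom_criterion M N (f : 'Hom(M, N)) :
  (forall v x, f (act M (e v) x) = act N (e v) (f x)) ->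
  (forall x, f (act M alpha x) = act N alpha (f x)) -> f \in homv M N.
Proof.
move=> fe fa; apply/homvP => a; elim/(nk_ind nkD): a => [|k a b Ha Hb|v l] x.
- by rewrite !act0E linear0.
- by rewrite !actDE !actZE linearD linearZ /= Ha Hb.
- rewrite !act_smul -fe; elim: l => [|l IH]; first by rewrite expr0 !act1E.
  by rewrite !act_exprS fa IH.
Qed.

(* [M alpha] is the radical of [M], so this is Nakayama's lemma. *)
Lemma nakayama_full M (U : {vspace M}) :
  (forall x, x \in U -> act M alpha x \in U) ->
  (forall x, exists2 y, y \in U & exists z, x = y + act M alpha z) -> U = fullv.
Proof.
move=> Ua UM; apply/vspaceP => x; rewrite memvf.
suff [y yU [z ->]] : exists2 y, y \in U & exists z, x = y + act M (alpha ^+ m) z.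
  by rewrite act_nil addr0.
(* Induction on [l] in [M = U + M alpha^l], substituting [M = U + M alpha] into itself. *)
elim: m => [|l [y yU [z ->]]].
  by exists 0; rewrite ?mem0v //; exists x; rewrite add0r expr0 act1E.
have [y' y'U [z' ->]] := UM z; exists (y + act M (alpha ^+ l) y').
  rewrite memvD //; elim: l {yU} => [|l IH]; first by rewrite expr0 act1E.
  by rewrite act_exprS Ua.
by exists z'; rewrite linearD /= addrA -act_smul smul_exprS.
Qed.

Lemma rad_full_eq0 M : (forall x : M, exists z, x = act M alpha z) ->
  forall x : M, x = 0.
Proof.
move=> Ma x; have : x \in (0%VS : {vspace M}).
  rewrite (@nakayama_full M 0%VS) ?memvf // => [y|y].
    by rewrite memv0 => /eqP ->; rewrite linear0 mem0v.
  have [z ->] := Ma y; exists 0; first exact: mem0v.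
  by exists z; rewrite add0r.
by rewrite memv0 => /eqP.
Qed.

(** The last power of [alpha] that does not kill [x] carries it into the socle. Injectivity and
    nondegeneracy are tested on socles in this way. *)
Lemma soc_neq0 M (x : M) : x != 0 -> exists l, act M (alpha ^+ l) x != 0 /\
  act M (alpha ^+ l.+1) x = 0.
Proof.
move=> x0; have ex : exists l, act M (alpha ^+ l) x == 0.
  by exists m; rewrite act_nil.
case: (ex_minnP ex) => -[|l] /eqP xl minl.
  by move: x0; rewrite -[x]act1E -(expr0 alpha) xl eqxx.
exists l; split=> //; apply/negP => /minl; by rewrite ltnn.
Qed.

Lemma idem_neq0 v : e v != 0.
Proof. by apply: contraNneq (nk_nz nkD v) => ->; rewrite smul0r. Qed.

Section Free.
Variables (P : fdmod A s) (v : V) (u : P).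
Hypothesis fP : free_on (e v) u.

Lemma free_gen_local x : exists k y, x = k *: u + act P alpha y.
Proof.
have [ue gen _] := fP; have [a ->] := gen x.
rewrite -ue -act_smul; have [k [b ->]] := nk_local nkD a v.
exists k, (act P b u); rewrite actDE actZE act_smul ue.
by [].
Qed.

Lemma free_neq0 : u != 0.
Proof.
have [_ _ ann] := fP; apply: contraNneq (idem_neq0 v) => u0.
by rewrite -[e v](smulr1 s) ann // u0 linear0.
Qed.

Lemma gen_notin_rad z : u <> act P alpha z.
Proof.
move=> uz; have [_ gen _] := fP; case/eqP: free_neq0.
apply: rad_full_eq0 => x; have [a ->] := gen x; rewrite uz.
by have [b ->] := act_alphaC a z; exists (act P b z).
Qed.

End Free.

(** Solving the equation for [e v ** a] and substituting the result into itself pushes this element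
    into every [alpha^l A], since [alpha] is normal; and [alpha] is nilpotent. *)
Lemma scaled_idem_cancel v k r a : k != 0 -> (k *: e v + r ** alpha) ** (e v ** a) = 0 ->
  e v ** a = 0.
Proof.
move=> k0 E; suff [b ->] : exists b, e v ** a = alpha ^+ m ** b.
  by rewrite (nk_nil nkD) smul0r.
elim: m => [|l [b bE]]; first by exists (e v ** a); rewrite expr0 smul1r.
have : e v ** a = - k^-1 *: (r ** alpha ** (e v ** a)).
  apply: (scalerI k0); move/eqP: E; rewrite smulDl addr_eq0 smulZl smulA (nk_idem1 nkD).
  by move=> /eqP ->; rewrite scalerA mulrN mulfV // scaleN1r.
rewrite {2}bE -(smulA _ r) [alpha ** (_ ** _)]smulA smul_exprS smulA.
have [c ->] := nk_normal nkD r l.+1; move=> ->.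
by exists (- k^-1 *: (c ** b)); rewrite smulZr smulA.
Qed.

Lemma idem_notin_rad v b : e v <> b ** alpha.
Proof.
move=> ve; case/eqP: (idem_neq0 v); rewrite -(nk_idem1 nkD).
apply: (@scaled_idem_cancel v 1 (- b)); first exact: oner_neq0.
by rewrite (nk_idem1 nkD) scale1r smulNl -ve subrr smul0r.
Qed.

(* [x0] plays the role of the image of [w] under a splitting of A -> P. *)
Lemma free_of_split P v (w : P) (x0 : A) :
  act P (e v) w = w -> (forall x, exists a, x = act P a w) -> w != 0 ->
  act P x0 w = w -> (forall a, act P a w = 0 -> x0 ** a = 0) -> free_on (e v) w.
Proof.
move=> we gen w0 wx0 ann; split=> // a wa.
have [k [r xE]] := nk_local nkD (x0 ** e v) v.
have E : (k *: e v + r ** alpha) ** (e v ** a) = 0.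
  rewrite -xE -!smulA [e v ** (e v ** _)]smulA (nk_idem1 nkD) ann ?smulr0 //.
  by rewrite act_smul we.
(* If [k = 0], the splitting puts the generator [w] into the radical and the module vanishes;
   otherwise the factor can be cancelled. *)
have [k0|k0] := eqVneq k 0; last exact: scaled_idem_cancel k0 E.
case/eqP: w0; apply: rad_full_eq0 => x; have [b ->] := gen x.
have -> : w = act P alpha (act P r w).
  rewrite -act_smul -[r ** alpha](add0r) -(scale0r (e v)) -k0 -xE.
  by rewrite !act_smul we wx0 we.
by have [c ->] := act_alphaC b (act P r w); exists (act P c (act P r w)).
Qed.

(** Projectivity splits the surjection [A -> P] given by [w], and the image of [w] under the
    splitting is the element needed in [free_of_split]. *)
Lemma projective_free P v (w : P) : projective P ->
  act P (e v) w = w -> (forall x, exists a, x = act P a w) -> w != 0 ->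
  free_on (e v) w.
Proof.
move=> pP we gen w0.
have [||k kH kE] := pP (regular A s) P (orbit_map w) \1%VF (orbit_map_hom w).
- apply/vspaceP => x; rewrite memvf; have [a ->] := gen x.
  by rewrite -orbit_mapE memv_img ?memvf.
- by apply/homvP => a x; rewrite !id_lfunE.
apply: (free_of_split (x0 := k w)) => // [|a wa].
  by move/lfunP/(_ w): kE; rewrite comp_lfunE orbit_mapE id_lfunE.
by rewrite -act_regular; move/homvP: kH => <-; rewrite wa linear0.
Qed.

(** The simple module at the vertex [v], encoded by a spanning vector so that duals, transposes and
    isomorphic copies are recognised without building quotients. *)
Definition simple_at v M : Prop := exists z : M,
  [/\ z != 0, forall x, exists k, x = k *: z, act M (e v) z = z & act M alpha z = 0].

Lemma proj_cover_simple v (S P : fdmod A s) (p : 'Hom(P, S)) : simple_at v S ->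
  projective P -> p \in homv P S -> limg p = fullv -> superfluous (lker p) ->
  exists2 u : P, free_on (e v) u & p u != 0.
Proof.
move=> [z [z0 zgen ze za]] pP pH pS sup.
have : z \in limg p by rewrite pS memvf.
case/memv_imgP => u1 _ zE; pose u := act P (e v) u1.
have pu : p u = z by move/homvP: pH => ->; rewrite -zE.
have u0 : u != 0 by apply: contraNneq z0 => u0; rewrite -pu u0 linear0.
have ue : act P (e v) u = u by rewrite -act_smul (nk_idem1 nkD).
exists u; last by rewrite pu.
apply: projective_free => // x; suff : x \in limg (orbit_map u).
  by case/memv_imgP => a _ ->; exists a; rewrite orbit_mapE.
(* [u A] and the kernel of [p] span [P] because [S] is a line; superfluity leaves [u A = P]. *)
rewrite (sup (limg (orbit_map u))) ?memvf //.
  move=> a y /memv_imgP[b _ ->]; rewrite orbit_mapE -act_smul -orbit_mapE.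
  exact: memv_img (memvf _).
apply/vspaceP => y; rewrite memvf; have [k kE] := zgen (p y).
rewrite -[y](addrNK (k *: u)) memv_add //.
  by rewrite memv_ker linearB linearZ /= pu kE subrr.
by rewrite memvZ //; apply/memv_imgP; exists 1; rewrite ?memvf // orbit_mapE act1E.
Qed.

End Modules.
End Nakayama.

(** * Simple modules and their transposes *)

Section Simple.
Variables (K : fieldType) (A : falgType K).
Variables (s : side) (V : finType) (e : V -> A) (sigma sigma' : V -> V).
Variables (alpha : A) (m : nat).
Hypothesis nkD : nakayama s e sigma sigma' alpha m.
Local Notation "a ** b" := (smul s a b) (at level 40, left associativity).
Implicit Types (M N P S : fdmod A s) (a b : A) (v w : V).

Lemma dualE M a (f : dual M) (x : M) :
  (act (dual M) a f : 'Hom(M, K^o)) x = (f : 'Hom(M, K^o)) (act M a x).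
Proof.
pose L : {linear 'Hom(M, K^o) -> 'Hom(M, K^o)} := HB.pack
  (fun g : 'Hom(M, K^o) => (g \o act M a)%VF)
  (GRing.isLinear.Build _ _ _ _ _ (@dual_act_fun_is_linear K A s M a)).
by rewrite -[LHS]/((linfun L f) x) lfunE /= comp_lfunE.
Qed.

Lemma starE M a (f : star M) (x : M) :
  vsval (act (star M) a f) x = a ** (vsval f x).
Proof.
pose L : {linear star M -> star M} := HB.pack
  (fun g : star M => vsproj (homv M (regular A s))
     (act (regular A (opp_side s)) a \o vsval g)%VF : star M)
  (GRing.isLinear.Build _ _ _ _ _ (@star_act_fun_is_linear K A s M a)).
rewrite -[act _ _ _]/(linfun L f) lfunE /= star_actE comp_lfunE act_regular.
exact: smul_opp.
Qed.

Lemma simple_rad v M : simple_at e alpha v M -> forall x : M, act M alpha x = 0.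
Proof.
by move=> [z [_ gen _ za]] x; have [k ->] := gen x; rewrite linearZ /= za scaler0.
Qed.

Lemma idem_act v w M (x : M) : act M (e v) x = x ->
  act M (e w) x = if v == w then x else 0.
Proof.
move=> xe; rewrite -{1}xe -act_smul (nk_idem nkD).
by case: eqP => _; rewrite ?act0E.
Qed.

Lemma line_submodule v M (z : M) a :
  act M (e v) z = z -> act M alpha z = 0 -> exists k, act M a z = k *: z.
Proof.
move=> ze za; elim/(nk_ind nkD): a => [|k a b [ka Ea] [kb Eb]|w [|l]].
- by exists 0; rewrite act0E scale0r.
- by exists (k * ka + kb); rewrite actDE actZE Ea Eb scalerA scalerDl.
- exists (v == w)%:R; rewrite expr0 smulr1 (idem_act w ze).
  by case: eqP; rewrite ?scale1r ?scale0r.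
- exists 0; rewrite act_smul (idem_act w ze) scale0r; case: eqP => _.
    by rewrite -(smul_exprS s) act_smul za linear0.
  by rewrite linear0.
Qed.

Lemma simple_iso v M N : mod_iso M N -> simple_at e alpha v M -> simple_at e alpha v N.
Proof.
move=> [f /homvP fH [f0 fS]] [z [z0 gen ze za]]; exists (f z); split.
- apply: contraNneq z0 => fz; rewrite -memv0 -f0 memv_ker fz //.
- move=> x; have : x \in limg f by rewrite fS memvf.
  case/memv_imgP => y _ ->; have [k ->] := gen y; exists k; exact: linearZ.
- by rewrite -fH ze.
- by rewrite -fH za linear0.
Qed.

Lemma simple_dual v M : simple_at e alpha v M -> simple_at e alpha v (dual M).
Proof.
move=> [z [z0 gen ze za]]; have [f fz] := dual_coord z0; exists f; split.
- by apply/eqP => f0; move: fz; rewrite f0 zero_lfunE => /eqP; rewrite eq_sym oner_eq0.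
- move=> g; exists ((g : 'Hom(M, K^o)) z); apply/lfunP => x; have [k ->] := gen x.
  by rewrite scale_lfunE !linearZ /= fz [_ *: 1]mulr1.
- apply/lfunP => x; rewrite dualE; have [k ->] := gen x.
  by rewrite linearZ /= ze.
- apply/lfunP => x; rewrite dualE; have [k ->] := gen x.
  by rewrite linearZ /= za scaler0 linear0 zero_lfunE.
Qed.

Lemma simple_lift v S M (z : S) (x : M) :
  z != 0 -> (forall y, exists k, y = k *: z) -> act S (e v) z = z ->
  act S alpha z = 0 -> act M (e v) x = x -> act M alpha x = 0 ->
  exists2 f : 'Hom(S, M), f \in homv S M & f z = x.
Proof.
move=> z0 gen ze za xe xa; have [c cz] := dual_coord z0.
have [f fE'] := rank_one_map c x.
have fE k : f (k *: z) = k *: x by rewrite fE' linearZ /= cz [_ *: 1]mulr1.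
exists f; last by rewrite -[z]scale1r fE scale1r.
apply: (hom_criterion nkD) => [w y|y]; have [k ->] := gen y.
  rewrite [act S _ _]linearZ fE [act M _ _]linearZ /= (idem_act w ze) (idem_act w xe).
  by case: eqP; rewrite ?fE // !scaler0 linear0.
by rewrite [act S _ _]linearZ fE [act M _ _]linearZ /= za xa !scaler0 linear0.
Qed.

Lemma simple_at_iso v M N :
  simple_at e alpha v M -> simple_at e alpha v N -> mod_iso M N.
Proof.
move=> [z [z0 gen ze za]] [x [x0 gen' xe xa]].
have [f fH fz] := simple_lift z0 gen ze za xe xa; exists f => //; split.
  apply/eqP/lker0P => y y'; have [[k ->] [k' ->]] := (gen y, gen y').
  rewrite !linearZ /= fz => /eqP; rewrite -subr_eq0 -scalerBl scaler_eq0 (negbTE x0).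
  by rewrite orbF subr_eq0 => /eqP ->.
apply/vspaceP => y; rewrite memvf; have [k ->] := gen' y.
by rewrite -fz -linearZ memv_img ?memvf.
Qed.

Lemma simple_at_inj v w M : simple_at e alpha v M -> simple_at e alpha w M -> v = w.
Proof.
move=> [z [z0 gen ze _]] [x [x0 _ xe _]]; have [k xk] := gen x.
apply/eqP/negPn/negP => vw; move: xe; rewrite xk linearZ /= (idem_act w ze).
rewrite (negbTE vw) scaler0 -xk => /esym/eqP; by rewrite (negbTE x0).
Qed.

(** The presentation is generated by [u] at [v] and [w] at [sigma v], with [w] sent to [u alpha].
    Evaluation at [w] and [u] turns its A-dual into right multiplication by [alpha] from [A e_v] to
    [A e_(sigma v)], so the cokernel is the top of the latter. *)
Lemma transpose_simple v M (N : fdmod A (opp_side s)) :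
  simple_at e alpha v M -> is_transpose M N -> simple_at e alpha (sigma v) N.
Proof.
move=> Mv [P1 [P0 [p1 [p0 [[[pP1 pP0] [p1H p0H] p0S im [sup0 sup1]] [q [qH qS qK]]]]]]].
have [u fu pu] := proj_cover_simple nkD Mv pP0 p0H p0S sup0.
have [ue gen ann] := fu.
have kerE x : (x \in lker p0) <-> exists y, x = act P0 alpha y.
  split=> [|[y ->]].
    rewrite memv_ker; have [k [y ->]] := free_gen_local nkD fu x.
    rewrite linearD linearZ /=; move/homvP: p0H => ->.
    rewrite (simple_rad Mv) addr0 scaler_eq0 (negbTE pu) orbF => /eqP ->.
    by exists y; rewrite scale0r add0r.
  by rewrite memv_ker; move/homvP: p0H => ->; rewrite (simple_rad Mv).
have : act P0 alpha u \in limg p1 by rewrite im; apply/kerE; exists u.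
case/memv_imgP => w1 _ w1E; pose w := act P1 (e (sigma v)) w1.
have [/homvP p1H' /homvP qH'] := (p1H, qH).
have pw : p1 w = act P0 alpha u.
  by rewrite p1H' -w1E -act_smul -(nk_comm nkD) act_smul ue.
have we : act P1 (e (sigma v)) w = w by rewrite -act_smul (nk_idem1 nkD).
(* The point where arrows must not vanish: if [e v ** alpha] were zero, the simple module could be
   projective. *)
have w0 : w != 0.
  apply: contraNneq (nk_nz nkD v) => w0; apply/eqP; apply: ann.
  by rewrite -pw w0 linear0.
have wgen x : exists a, x = act P1 a w.
  suff : x \in limg (orbit_map w).
    by case/memv_imgP => a _ ->; exists a; rewrite orbit_mapE.
  rewrite (sup1 (limg (orbit_map w))) ?memvf //.
    move=> a y /memv_imgP[b _ ->]; rewrite orbit_mapE -act_smul -orbit_mapE.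
    exact: memv_img (memvf _).
  apply/vspaceP => y; rewrite memvf.
  have : p1 y \in lker p0 by rewrite -im memv_img ?memvf.
  case/kerE => t tE; have [a tu] := gen t.
  have [b bE] := act_alphaC' nkD a u.
  rewrite -[y](addrNK (orbit_map w b)) memv_add ?memv_img ?memvf //.
  by rewrite memv_ker linearB /= orbit_mapE p1H' pw tE tu bE subrr.
have fw := projective_free nkD pP1 we wgen w0.
have [_ _ annw] := fw.
(* With [extE], evaluation at [w] identifies the A-dual of [P1] with [A e_(sigma v)]. *)
have lift1 (a : A) : a ** e (sigma v) = a -> exists F : star P1, vsval F w = a.
  move=> ae; have [|f fH fE] := free_lift (M := regular A s) (x := a) fw.
    by rewrite act_regular.
  by exists (vsproj _ f); rewrite vsprojK.
have extE (F G : star P1) : vsval F w = vsval G w -> F = G.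
  move=> FG; apply: val_inj; exact: (free_hom_ext fw (valP F) (valP G) FG).
have [F0 F0w] := lift1 _ (nk_idem1 nkD (sigma v)).
(* The map with value [a alpha] at [w] comes from [P0]: it factors through the map with value [a] at
   [u]. *)
have kerq a (F : star P1) : a ** e v = a -> vsval F w = a ** alpha -> q F = 0.
  move=> ae Fw; apply/qK; have [|g gH gu] := free_lift (M := regular A s) (x := a) fu.
    by rewrite act_regular.
  exists (vsproj _ g); rewrite vsprojK //.
  apply: (free_hom_ext fw (valP F) (comp_homv gH p1H)).
  by rewrite Fw comp_lfunE pw; move/homvP: gH => ->; rewrite gu act_regular.
have n00 : q F0 != 0.
  apply/eqP => /qK [g gE]; have := F0w; rewrite gE comp_lfunE pw.
  have /homvP -> := valP g; rewrite act_regular => /esym.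
  exact: (idem_notin_rad nkD (v:=sigma v) (b:= vsval g u : A)).
exists (q F0); split=> //.
- move=> n; have : n \in limg q by rewrite qS memvf.
  case/memv_imgP => F _ ->; have Fw : vsval F w ** e (sigma v) = vsval F w.
    by rewrite -act_regular; have /homvP <- := valP F; rewrite we.
  have [k [b E]] := nk_local' nkD (vsval F w) (sigma v).
  exists k; apply/eqP; rewrite -subr_eq0 -linearZ -linearB /=; apply/eqP.
  (* The remainder [b alpha] ends at [sigma v], hence equals [b e_v alpha]. *)
  apply: (kerq (b ** e v)); first by rewrite -smulA (nk_idem1 nkD).
  rewrite linearB linearZ /= add_lfunE scale_lfunE opp_lfunE scalerN F0w.
  have bE : b ** alpha = vsval F w - k *: e (sigma v) by rewrite -Fw E addrC addKr.
  rewrite -smulA (nk_comm nkD) smulA bE smulDl smulNl smulZl Fw (nk_idem1 nkD).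
  by [].
- rewrite -qH'; congr (q _); apply: extE.
  by rewrite starE F0w (nk_idem1 nkD).
- rewrite -qH'; apply: (kerq (e v)); first exact: nk_idem1 nkD _.
  by rewrite starE F0w (nk_comm nkD).
Qed.

End Simple.

(** * Socles and tops of indecomposable projective modules *)

Section Submodule.
Variables (K : fieldType) (A : falgType K) (s : side) (M : fdmod A s).
Variables (U : {vspace M}) (subU : submodule U).

Let act_fun (a : A) (x : subvs_of U) : subvs_of U := vsproj U (act M a (vsval x)).
Lemma submod_actE a x : vsval (act_fun a x) = act M a (vsval x).
Proof. by rewrite vsprojK //; apply: subU; exact: subvsP. Qed.
Fact submod_act_fun_is_linear a : linear (act_fun a).
Proof.
move=> k x y; rewrite /act_fun linearP /=. exact: (linearP (vsproj U)).
Qed.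
HB.instance Definition _ a := GRing.isSemilinear.Build K _ _ _ (act_fun a)
  (GRing.semilinear_linear (submod_act_fun_is_linear a)).
Let sact (a : A) : 'End(subvs_of U) := linfun (act_fun a).
Fact submod_act_is_linear : linear sact.
Proof.
move=> k a b; apply/lfunP => x; rewrite add_lfunE scale_lfunE !lfunE /=.
by rewrite /act_fun actDE actZE linearP.
Qed.
HB.instance Definition _ := GRing.isSemilinear.Build K _ _ _ sact
  (GRing.semilinear_linear submod_act_is_linear).
Fact submod_act1 : sact 1 = \1%VF.
Proof.
by apply/lfunP => x; apply: val_inj; rewrite lfunE /= submod_actE act1E id_lfunE.
Qed.
Fact submod_actM a b : sact (a * b) = side_comp s (sact a) (sact b).
Proof.
apply/lfunP => x; apply: val_inj; rewrite lfunE /= submod_actE actM.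
symmetry; apply: (@side_comp_morph K _ _ _ _ _ _ _ (fun y : subvs_of U => vsval y)) => y.
- by rewrite lfunE /= submod_actE.
- by rewrite lfunE /= submod_actE.
Qed.
Definition submod : fdmod A s := FdMod submod_act1 submod_actM.

Lemma submodE a (x : submod) : vsval (act submod a x) = act M a (vsval x).
Proof. by rewrite lfunE /= submod_actE. Qed.

End Submodule.

Section Length.
Variables (K : fieldType) (A : falgType K).
Variables (s : side) (V : finType) (e : V -> A) (alpha : A) (m : nat).

(** The exponent c(v) of the overview for the right side, d(v) for the left side. When no exponent
    below [m] works, [find] returns [m], which is correct because [alpha ^+ m = 0]. *)
Definition path_length (v : V) : nat :=
  find (fun l => smul s (e v) (alpha ^+ l) == 0) (iota 0 m).

End Length.

Section FreeModules.
Variables (K : fieldType) (A : falgType K).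
Variables (s : side) (V : finType) (e : V -> A) (sigma sigma' : V -> V).
Variables (alpha : A) (m : nat).
Hypothesis nkD : nakayama s e sigma sigma' alpha m.
Local Notation "a ** b" := (smul s a b) (at level 40, left associativity).
Local Notation len := (path_length s e alpha m).
Local Notation len' := (path_length (opp_side s) e alpha m).
Implicit Types (M N P S : fdmod A s) (a b : A) (v w : V).

Lemma lenP v l : (e v ** alpha ^+ l != 0) = (l < len v)%N.
Proof.
have mono j i : e v ** alpha ^+ i = 0 -> (i <= j)%N -> e v ** alpha ^+ j = 0.
  by move=> E /subnKC <-; rewrite -(smul_exprD s) smulA E smul0r.
rewrite /path_length; set a := (fun l => _); set r := iota 0 m.
have [lt|le] := ltnP l (find a r).
  have /negbT := before_find 0%N lt; rewrite nth_iota //.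
  by rewrite (leq_trans lt) // -[m in X in (_ <= X)%N](size_iota 0) find_size.
apply/negbTE; rewrite negbK; apply/eqP.
have [hs|/hasNfind ns] := boolP (has a r).
  apply: (mono l (find a r)) => //; have := nth_find 0%N hs; rewrite nth_iota.
    by move/eqP.
  by move: hs; rewrite has_find size_iota.
move: le; rewrite ns size_iota => le; apply: (mono l m) => //.
by rewrite (nk_nil nkD) smulr0.
Qed.

Lemma len_gt0 v : (0 < len v)%N.
Proof. by rewrite -lenP expr0 smulr1 (idem_neq0 nkD). Qed.

Lemma len_nil v : e v ** alpha ^+ len v = 0.
Proof. by apply/eqP; rewrite -[_ == _]negbK lenP ltnn. Qed.

Lemma act_orbit_nil M v (u : M) a l : act M (e v) u = u -> (len v <= l)%N ->
  act M (alpha ^+ l) (act M a u) = 0.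
Proof.
move=> ue /subnKC <-; rewrite -act_smul.
have [b ->] := nk_normal nkD a (len v + (l - len v)).
rewrite -(smul_exprD s) -ue -act_smul -!smulA.
by rewrite smulA len_nil smul0r act0E.
Qed.

(** A socle element of [u A] sinks down the filtration by the [u A alpha^l] to its last term, a
    line. It is stated for any [u] at [v] with a longest possible nonzero orbit, since it also
    serves for an idempotent inside the regular module. *)
Lemma cyclic_socle M v (u : M) a : act M (e v) u = u ->
  act M (alpha ^+ (len v).-1) u != 0 -> act M alpha (act M a u) = 0 ->
  exists k, act M a u = k *: act M (alpha ^+ (len v).-1) u.
Proof.
move=> ue un xa; set x := act M a u in xa *.
have loc b : exists k c, act M b u = k *: u + act M alpha (act M c u).
  have [k [c E]] := nk_local nkD b v; exists k, c.
  by rewrite -[u in LHS]ue -act_smul E actDE actZE act_smul ue.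
suff claim l : (l <= (len v).-1)%N -> exists b, x = act M (alpha ^+ l) (act M b u).
  have [b ->] := claim _ (leqnn _); have [k [c ->]] := loc b; exists k.
  rewrite linearD linearZ /= -act_smul smul_exprS (act_orbit_nil c ue) ?addr0 //.
  exact: leqSpred.
elim: l => [_|l IH lt]; first by exists a; rewrite expr0 act1E.
have [b xE] := IH (ltnW lt); have [k [c bE]] := loc b.
(* Multiplying by the missing power of [alpha] sends [x] to [k] times the last nonzero vector, so
   [k = 0]. *)
have : act M (alpha ^+ ((len v).-1 - l)) x = 0.
  by rewrite -(prednK (n := _ - l)) ?subn_gt0 // -(smul_exprS s) act_smul xa linear0.
rewrite {1}xE -act_smul smul_exprD subnKC ?(ltnW lt) // bE linearD linearZ /=.
rewrite -act_smul smul_exprS (act_orbit_nil c ue) ?leqSpred // addr0 => /eqP.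
rewrite scaler_eq0 (negbTE un) orbF => /eqP k0; exists c.
by rewrite xE bE k0 scale0r add0r -act_smul smul_exprS.
Qed.

End FreeModules.

Section FreeStructure.
Variables (K : fieldType) (A : falgType K).
Variables (s : side) (V : finType) (e : V -> A) (sigma sigma' : V -> V).
Variables (alpha : A) (m : nat).
Hypothesis nkD : nakayama s e sigma sigma' alpha m.
Local Notation "a ** b" := (smul s a b) (at level 40, left associativity).
Local Notation len := (path_length s e alpha m).
Implicit Types (M N P S T : fdmod A s) (a b : A) (v w : V).

Lemma ker_alpha_submodule M : submodule (lker (act M alpha)).
Proof.
move=> a x; rewrite !memv_ker => /eqP xa.
by have [b ->] := act_alphaC' nkD a x; rewrite xa linear0.
Qed.

Lemma img_alpha_submodule M (U : {vspace M}) :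
  submodule U -> submodule (act M alpha @: U)%VS.
Proof.
move=> sU a x /memv_imgP[y yU ->]; have [b ->] := act_alphaC nkD a y.
by apply: memv_img; apply: sU.
Qed.

Section Free.
Variables (P : fdmod A s) (v : V) (u : P).
Hypothesis fP : free_on (e v) u.

Lemma free_pow_neq0 l : (l < len v)%N -> act P (alpha ^+ l) u != 0.
Proof.
rewrite -(lenP nkD); apply: contraNneq => ul; have [_ _ ann] := fP.
by apply/eqP; exact: ann.
Qed.

Definition socle_gen : P := act P (alpha ^+ (len v).-1) u.

Lemma socle_gen_neq0 : socle_gen != 0.
Proof. by apply: free_pow_neq0; rewrite prednK ?(len_gt0 nkD). Qed.

Lemma socle_gen_ker : act P alpha socle_gen = 0.
Proof.
have [ue _ _] := fP; rewrite -act_exprS prednK ?(len_gt0 nkD) //.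
by rewrite -[u]act1E (act_orbit_nil nkD _ ue).
Qed.

Lemma socle_gen_idem : act P (e (iter (len v).-1 sigma v)) socle_gen = socle_gen.
Proof.
by have [ue _ _] := fP; rewrite -act_smul -(nk_pow nkD) act_smul ue.
Qed.

Lemma socle_gen_span (x : P) : act P alpha x = 0 -> exists k, x = k *: socle_gen.
Proof.
have [ue gen _] := fP; have [a ->] := gen x => xa.
exact: (cyclic_socle nkD ue socle_gen_neq0 xa).
Qed.

Lemma ker_alpha_simple : simple_submodule (lker (act P alpha)).
Proof.
have zk : socle_gen \in lker (act P alpha) by rewrite memv_ker socle_gen_ker.
split; first exact: ker_alpha_submodule.
  by apply: contraNneq socle_gen_neq0 => k0; rewrite -memv0 -k0.
move=> U sU UL; have [->|/eqP U0] := eqVneq U 0%VS; [by left | right].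
have [x xU x0] : exists2 x, x \in U & x != 0.
  by exists (vpick U); rewrite ?memv_pick ?vpick0 //; apply/eqP.
have xk := subvP UL _ xU; move: xk; rewrite memv_ker => /eqP /socle_gen_span [k xE].
apply/eqP; rewrite eqEsubv UL; apply/subvP => y; rewrite memv_ker => /eqP.
case/socle_gen_span => l ->; rewrite memvZ //.
have k0 : k != 0 by apply: contraNneq x0 => k0; rewrite xE k0 scale0r.
by rewrite -[socle_gen](scalerK k0) -xE memvZ.
Qed.

(** By simplicity [W alpha] is zero or [W]; in the second case [W = W alpha^m = 0]. *)
Lemma simple_submodule_le (W : {vspace P}) :
  simple_submodule W -> (W <= lker (act P alpha))%VS.
Proof.
move=> [sW W0 minW].
have aW : (act P alpha @: W <= W)%VS by apply/subvP => _ /memv_imgP[y yW ->]; apply: sW.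
case: (minW _ (img_alpha_submodule sW) aW) => [|aWE].
  by move=> /eqP; rewrite -lkerE.
case/eqP: W0; apply/eqP; rewrite -subv0; apply/subvP => x xW.
suff [y yW ->] : exists2 y, y \in W & x = act P (alpha ^+ m) y.
  by rewrite (act_nil nkD) mem0v.
elim: m => [|l [y yW ->]]; first by exists x; rewrite ?expr0 ?act1E.
move: yW; rewrite -{1}aWE => /memv_imgP[z zW ->]; exists z => //.
by rewrite -act_smul smul_exprS.
Qed.

Lemma free_socle (U : {vspace P}) : is_socle U <-> U = lker (act P alpha).
Proof.
split=> [[sU minU]|->].
  apply/eqP; rewrite eqEsubv (sU _ ker_alpha_simple) andbT.
  apply: minU; exact: simple_submodule_le.
split; first exact: simple_submodule_le.
by move=> W sW; apply: sW; exact: ker_alpha_simple.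
Qed.

Lemma free_soc S : is_soc P S -> simple_at e alpha (iter (len v).-1 sigma v) S.
Proof.
move=> [i [/homvP iH i0 /free_socle iS]].
have inj : injective i by apply/lker0P/eqP.
have : socle_gen \in limg i by rewrite iS memv_ker socle_gen_ker.
case/memv_imgP => z _ zE; exists z; split.
- by apply: contraNneq socle_gen_neq0 => z0; rewrite zE z0 linear0.
- move=> x; have : i x \in limg i by rewrite memv_img ?memvf.
  rewrite iS memv_ker => /eqP /socle_gen_span [k xE]; exists k.
  by apply: inj; rewrite xE linearZ /= zE.
- by apply: inj; rewrite iH -zE socle_gen_idem.
- by apply: inj; rewrite iH -zE socle_gen_ker linear0.
Qed.

Lemma simple_is_soc S : simple_at e alpha (iter (len v).-1 sigma v) S -> is_soc P S.
Proof.
move=> [z [z0 gen ze za]].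
have [i iH iz] := simple_lift nkD z0 gen ze za socle_gen_idem socle_gen_ker.
exists i; split=> //.
  apply/eqP; rewrite -subv0; apply/subvP => y; have [k ->] := gen y.
  rewrite memv_ker linearZ /= iz scaler_eq0 (negbTE socle_gen_neq0) orbF => /eqP ->.
  by rewrite scale0r mem0v.
apply/free_socle/eqP; rewrite eqEsubv; apply/andP; split; apply/subvP => x.
  case/memv_imgP => y _ ->; have [k ->] := gen y.
  by rewrite linearZ /= iz memvZ // memv_ker socle_gen_ker.
rewrite memv_ker => /eqP/socle_gen_span [k ->].
by rewrite -iz -linearZ memv_img ?memvf.
Qed.

(** An element outside the radical has a nonzero coefficient at the generator, so it generates
    modulo the radical and Nakayama's lemma applies. Thus [P] is a local module. *)
Lemma rad_or_full (U : {vspace P}) : submodule U ->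
  (U <= limg (act P alpha))%VS \/ U = fullv.
Proof.
move=> sU; have [?|/subvPn [x xU xr]] := boolP (U <= limg (act P alpha))%VS; first by left.
right; apply: (nakayama_full nkD) => [y yU|y]; first exact: sU.
have [k [t xE]] := free_gen_local nkD fP x.
have [l [t' yE]] := free_gen_local nkD fP y.
have k0 : k != 0.
  by apply: contraNneq xr => k0; rewrite xE k0 scale0r add0r memv_img ?memvf.
exists ((l / k) *: x); first exact: memvZ.
exists (t' - (l / k) *: t); rewrite yE xE scalerDr scalerA divfK // linearB linearZ /=.
by rewrite -addrA; congr (_ + _); rewrite [RHS]addrC subrK.
Qed.

Lemma gen_not_img_alpha : u \notin limg (act P alpha).
Proof. by apply/negP => /memv_imgP[z _]; exact: (gen_notin_rad nkD fP). Qed.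

Lemma free_indecomposable : indecomposable P.
Proof.
split.
  by apply/eqP => f0; case/eqP: (free_neq0 nkD fP); apply/eqP; rewrite -memv0 -f0 memvf.
move=> U W sU sW UW UW0.
case: (rad_or_full sU) => [Ur|Uf]; last by right; rewrite -UW0 Uf capfv.
case: (rad_or_full sW) => [Wr|Wf]; last by left; rewrite -UW0 Wf capvf.
have : (U + W <= limg (act P alpha))%VS by rewrite subv_add Ur.
by rewrite UW => /subvP/(_ u (memvf u)); rewrite (negbTE gen_not_img_alpha).
Qed.

Lemma img_alpha_maximal : maximal_submodule (limg (act P alpha)).
Proof.
split; first by apply: img_alpha_submodule => a x _; exact: memvf.
  by apply: contraNneq gen_not_img_alpha => ->; rewrite memvf.
move=> U sU lU; case: (rad_or_full sU) => [Ur|->]; [left | by right].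
by apply/eqP; rewrite eqEsubv Ur.
Qed.

Lemma maximal_submoduleE (W : {vspace P}) :
  maximal_submodule W -> W = limg (act P alpha).
Proof.
move=> [sW Wf maxW]; have [sR Rf _] := img_alpha_maximal.
case: (rad_or_full sW) => [Wr|WE]; last by rewrite WE eqxx in Wf.
by case: (maxW _ sR Wr) => // RE; rewrite RE eqxx in Rf.
Qed.

Lemma free_radical (U : {vspace P}) : is_radical U <-> U = limg (act P alpha).
Proof.
split=> [rU|->].
  apply/vspaceP => x; apply/idP/idP => [/rU|xr]; first by apply; exact: img_alpha_maximal.
  by apply/rU => W /maximal_submoduleE ->.
move=> x; split=> [xr W /maximal_submoduleE -> //|]; apply; exact: img_alpha_maximal.
Qed.

Lemma free_top T : is_top P T -> simple_at e alpha v T.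
Proof.
have [ue gen ann] := fP; move=> [p [/homvP pH pS /free_radical kE]].
exists (p u); split.
- by rewrite -memv_ker kE gen_not_img_alpha.
- move=> y; have : y \in limg p by rewrite pS memvf.
  case/memv_imgP => x _ ->; have [k [t ->]] := free_gen_local nkD fP x; exists k.
  rewrite linearD linearZ /=; suff -> : p (act P alpha t) = 0 by rewrite addr0.
  by apply/eqP; rewrite -memv_ker kE memv_img ?memvf.
- by rewrite -pH ue.
- by rewrite -pH; apply/eqP; rewrite -memv_ker kE memv_img ?memvf.
Qed.

Lemma simple_is_top T : simple_at e alpha v T -> is_top P T.
Proof.
move=> Tv; have [z [z0 gen ze za]] := Tv.
have [p pH pu] := free_lift fP ze; exists p; split=> //.
  apply/vspaceP => y; rewrite memvf; have [k ->] := gen y.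
  by rewrite -pu -linearZ memv_img ?memvf.
apply/free_radical/vspaceP => x; apply/idP/idP.
  have [k [t ->]] := free_gen_local nkD fP x.
  rewrite memv_ker linearD linearZ /=; move/homvP: pH => ->.
  rewrite (simple_rad Tv) addr0 pu scaler_eq0 (negbTE z0) orbF => /eqP ->.
  by rewrite scale0r add0r memv_img ?memvf.
case/memv_imgP => t _ ->; rewrite memv_ker; move/homvP: pH => ->.
by rewrite (simple_rad Tv).
Qed.

End Free.

Lemma ex_simple v M (z : M) : z != 0 -> act M (e v) z = z -> act M alpha z = 0 ->
  exists S, simple_at e alpha v S.
Proof.
move=> z0 ze za.
have sL : submodule <[z]>%VS.
  move=> a _ /vlineP[k ->]; have [l al] := line_submodule nkD a ze za.
  by rewrite linearZ /= al !memvZ // memv_line.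
exists (submod sL), (vsproj _ z); have zE : vsval (vsproj <[z]> z) = z.
  by rewrite vsprojK ?memv_line.
split.
- by apply: contraNneq z0 => z0; rewrite -zE z0 linear0.
- move=> x; have /vlineP[k xE] := subvsP x; exists k; apply: subvs_inj.
  exact: (etrans xE (congr1 ( *:%R k) (esym zE))).
- by apply: subvs_inj; rewrite submodE zE ze.
- by apply: subvs_inj; rewrite submodE zE za linear0.
Qed.

Lemma ex_free v : exists P, exists u : P, free_on (e v) u.
Proof.
pose U : {vspace regular A s} := limg (@orbit_map _ _ _ (regular A s) (e v)).
have UP x : reflect (exists a, x = e v ** a) (x \in U).
  apply: (iffP memv_imgP) => [[a _ ->]|[a ->]]; exists a; rewrite ?memvf //.
    exact: etrans (@orbit_mapE K A s (regular A s) (e v) a) (act_regular _ _ _).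
  exact: esym (etrans (@orbit_mapE K A s (regular A s) (e v) a) (act_regular _ _ _)).
have sU : submodule U.
  move=> a _ /UP[b ->]; apply/UP; exists (b ** a).
  by rewrite act_regular smulA.
have eU : e v \in U by apply/UP; exists 1; rewrite smulr1.
exists (submod sU), (vsproj U (e v)); split.
- apply: subvs_inj; rewrite submodE vsprojK // act_regular.
  exact: nk_idem1 nkD v.
- move=> y; have /UP[a yE] := subvsP y; exists a; apply: subvs_inj.
  by rewrite submodE vsprojK // act_regular.
- move=> a ua; rewrite -(act_regular s (e v) a) -[e v](vsprojK eU).
  by rewrite -(@submodE _ _ _ _ _ sU a (vsproj U (e v))) ua.
Qed.

End FreeStructure.

(** * Injective modules *)

Section Duality.
Variables (K : fieldType) (A : falgType K) (s : side).
Implicit Types (M N P : fdmod A s) (a b : A).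

(** Nondegeneracy of [phi] says that its orbit annihilates no nonzero vector, so the orbit is the
    whole dual. *)
Lemma dual_gen M (phi : dual M) :
  (forall x : M, (forall a, (phi : 'Hom(M, K^o)) (act M a x) = 0) -> x = 0) ->
  forall psi : dual M, exists a, psi = act (dual M) a phi.
Proof.
move=> nd psi; have : psi \in limg (orbit_map phi).
  rewrite [limg _]annihilator_full ?memvf // => x xU; apply: nd => a.
  by rewrite -dualE; apply: xU; rewrite -orbit_mapE memv_img ?memvf.
by case/memv_imgP => a _ ->; exists a; rewrite orbit_mapE.
Qed.

Definition orbit_functional M (phi : 'Hom(M, K^o)) (x : M) : 'Hom(A, K^o) :=
  (phi \o orbit_map x)%VF.

Lemma orbit_functionalE M (phi : 'Hom(M, K^o)) (x : M) a :
  orbit_functional phi x a = phi (act M a x).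
Proof. by rewrite comp_lfunE orbit_mapE. Qed.

Lemma orbit_functional_lfun M (phi : 'Hom(M, K^o)) :
  exists f : 'Hom(M, 'Hom(A, K^o)), forall x a, f x a = phi (act M a x).
Proof.
have lin : linear (orbit_functional phi).
  move=> k x y; apply/lfunP => a.
  by rewrite add_lfunE scale_lfunE !orbit_functionalE linearD linearZ /= linearD linearZ.
pose L : {linear M -> 'Hom(A, K^o)} := HB.pack (orbit_functional phi)
  (GRing.isLinear.Build _ _ _ _ _ lin).
by exists (linfun L) => x a; rewrite lfunE /= orbit_functionalE.
Qed.

(** [Th], sending [x] to the functional [a |-> phi (x a)], embeds [M] into D(A). Extending the
    single functional [phi \o h] from [X] to [Y] therefore extends [h], provided that the resulting
    functionals on [A] stay in the image of [Th]. *)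
Lemma dual_free_injective M e0 (phi : dual M) :
  free_on e0 phi -> injective_module M.
Proof.
move=> [phie gen ann] X Y g h /homvP gH g0 /homvP hH.
have phiE (x : M) a : (act (dual M) a phi : 'Hom(M, K^o)) x
    = (phi : 'Hom(M, K^o)) (act M a x) by exact: dualE.
have [mu0 mu0E] := functional_extension ((phi : 'Hom(M, K^o)) \o h)%VF g0.
(* Composing with [e0] changes nothing on the image of [g], where [phi] is fixed by [e0], and makes
   [a |-> mu (y a)] vanish on the annihilator of [phi]. *)
pose mu : 'Hom(Y, K^o) := (mu0 \o act Y e0)%VF.
have muE x : mu (g x) = (phi : 'Hom(M, K^o)) (h x).
  by rewrite comp_lfunE -gH mu0E comp_lfunE hH -phiE phie.
have [Th ThE] := orbit_functional_lfun (phi : 'Hom(M, K^o)).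
have [Xi XiE] := orbit_functional_lfun mu.
have Thinj : lker Th = 0%VS.
  apply/eqP; rewrite -subv0; apply/subvP => x; rewrite memv_ker => /eqP Thx.
  rewrite memv0; apply/negPn/negP => /dual_coord [psi psix].
  have [a aE] := gen psi; move: psix; rewrite aE phiE -ThE Thx zero_lfunE => /eqP.
  by rewrite eq_sym oner_eq0.
have XiTh y : Xi y \in limg Th.
  pose sec : 'Hom('Hom(M, K^o), A) := (orbit_map phi)^-1%VF.
  (* The functional [Xi y] depends on [a] only through [a phi], so it defines a functional on the
     dual of [M], which is evaluation at some [q]. *)
  have [q qE] := bidual_eval (Xi y \o sec)%VF.
  apply/memv_imgP; exists q; rewrite ?memvf //; apply/lfunP => a.
  rewrite ThE -phiE qE comp_lfunE; set c := sec _; apply/eqP; rewrite -subr_eq0 -linearB /=.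
  have ca : act (dual M) (a - c) phi = 0.
    rewrite actBE -[act _ c _]orbit_mapE limg_lfunVK ?subrr //.
    by rewrite -orbit_mapE memv_img ?memvf.
  have := ann _ ca; rewrite smul_opp => ca0.
  by rewrite XiE /mu comp_lfunE -act_smul ca0 act0E linear0.
have /lker0P Thinj' : lker Th == 0%VS by apply/eqP.
pose k : 'Hom(Y, M) := (Th^-1 \o Xi)%VF.
have kE y a : (phi : 'Hom(M, K^o)) (act M a (k y)) = mu (act Y a y).
  by rewrite -ThE comp_lfunE limg_lfunVK // XiE.
exists k.
  apply/homvP => a y; apply: Thinj'; apply/lfunP => b.
  by rewrite !ThE kE -!act_smul kE.
apply/lfunP => x; rewrite comp_lfunE; apply: Thinj'; apply/lfunP => a.
by rewrite !ThE kE -gH muE hH.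
Qed.

End Duality.

(** * Which indecomposable projective modules are injective *)

Section NakayamaDuality.
Variables (K : fieldType) (A : falgType K).
Variables (s : side) (V : finType) (e : V -> A) (sigma sigma' : V -> V).
Variables (alpha : A) (m : nat).
Hypothesis nkD : nakayama s e sigma sigma' alpha m.
Local Notation "a ** b" := (smul s a b) (at level 40, left associativity).
Local Notation len := (path_length s e alpha m).
Local Notation len' := (path_length (opp_side s) e alpha m).
Implicit Types (M N P S : fdmod A s) (a b : A) (v w : V).

Let nkO := nakayama_opp nkD.

Lemma nk_pow' v l : alpha ^+ l ** e v = e (iter l sigma' v) ** alpha ^+ l.
Proof. by have := nk_pow nkO v l; rewrite !smul_opp. Qed.

(** If the longest path from [v] could be prolonged backwards, multiplication by the preceding arrow
    would embed [P] into [A], as it would not kill the simple socle. A retraction of this embedding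
    would put the generator [u] into the radical. *)
Lemma free_injective_inv P v (u : P) : free_on (e v) u -> injective_module P ->
  e (sigma' v) ** alpha ^+ len v = 0.
Proof.
move=> fP injP; have [ue gen ann] := fP.
have xe : act (regular A s) (e v) (alpha ** e v) = alpha ** e v.
  by rewrite act_regular -smulA (nk_idem1 nkD).
have [j jH ju] := free_lift (M := regular A s) fP xe.
have jS : j (socle_gen e alpha m v u) = e (sigma' v) ** alpha ^+ len v.
  move/homvP: jH => ->; rewrite ju act_regular.
  have := nk_pow' v 1; rewrite expr1 => ->; rewrite -smulA smul_exprS.
  by rewrite prednK ?(len_gt0 nkD).
apply/eqP/negPn/negP => jn0.
have j0 : lker j = 0%VS.
  apply/eqP; rewrite -subv0; apply/subvP => x; rewrite memv_ker => /eqP jx.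
  rewrite memv0; apply/negPn/negP => /(soc_neq0 nkD) [l [xl0 xl1]].
  rewrite act_exprS in xl1; have [k xlE] := socle_gen_span nkD fP xl1.
  have : j (act P (alpha ^+ l) x) = 0 by move/homvP: jH => ->; rewrite jx linear0.
  rewrite xlE linearZ /= jS => /eqP; rewrite scaler_eq0 (negbTE jn0) orbF => /eqP k0.
  by rewrite xlE k0 scale0r eqxx in xl0.
have [|k kH kj] := injP P (regular A s) j \1%VF jH j0.
  by apply/homvP => a x; rewrite !id_lfunE.
apply: (gen_notin_rad nkD fP (z := k (e (sigma' v)))).
rewrite -[u in LHS]id_lfunE -kj comp_lfunE ju; move/homvP: kH => <-.
by rewrite act_regular; have := nk_pow' v 1; rewrite expr1 => ->.
Qed.

(** The functional [phi] detects the end of the maximal path. It is nondegenerate because [P] has a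
    simple socle, and it is free because the same path spans the socle of [A e_w]: this is where
    [len' w = len v] enters. *)
Lemma maximal_path_dual_free P v w (u : P) : free_on (e v) u ->
  w = iter (len v).-1 sigma v -> len' w = len v ->
  exists phi : dual P, free_on (e w) phi.
Proof.
move=> fP wE lenw; have [ue gen ann] := fP.
pose z := socle_gen e alpha m v u; have z0 : z != 0 := socle_gen_neq0 nkD fP.
have ze : act P (e w) z = z by rewrite wE (socle_gen_idem nkD fP).
have [phi0 phi0z] := dual_coord z0.
pose phi : dual P := (phi0 \o act P (e w))%VF.
have phiE x : (phi : 'Hom(P, K^o)) x = phi0 (act P (e w) x) by rewrite comp_lfunE.
have phiz : (phi : 'Hom(P, K^o)) z = 1 by rewrite phiE ze.
exists phi; split.
- by apply/lfunP => x; rewrite dualE !phiE -act_smul (nk_idem1 nkD).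
- apply: dual_gen => x xn; apply/eqP/negPn/negP => /(soc_neq0 nkD) [l [xl0 xl1]].
  rewrite act_exprS in xl1; have [k xlE] := socle_gen_span nkD fP xl1.
  have := xn (alpha ^+ l); rewrite xlE linearZ /= phiz [_ *: 1]mulr1 => k0.
  by rewrite xlE k0 scale0r eqxx in xl0.
- move=> a phia; rewrite smul_opp; apply/eqP/negPn/negP => ae0.
  have phia0 x : (phi : 'Hom(P, K^o)) (act P a x) = 0.
    by rewrite -dualE phia zero_lfunE.
  pose R := regular A (opp_side s).
  have RE b c : act R b c = b ** c by rewrite act_regular smul_opp.
  (* A nonzero [a e_w] that kills [phi] is pushed into the socle of [A e_w], where it becomes a
     multiple of the maximal path. *)
  have [l [xl0 xl1]] := soc_neq0 nkO (M := R) (x := a ** e w) ae0.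
  rewrite act_exprS !RE smulA in xl0 xl1.
  have ew : act R (e w) (e w) = e w by rewrite RE (nk_idem1 nkD).
  have [||k kE] := cyclic_socle (M := R) (u := e w : R) (a := alpha ^+ l ** a) nkO ew.
  + rewrite RE -smul_opp (lenP nkO) prednK //; exact: (len_gt0 nkO).
  + by rewrite !RE !smulA in xl1 *.
  rewrite !RE in kE.
  have k0 : k != 0.
    by apply: contraNneq xl0 => k0; rewrite kE k0 scale0r.
  have : (phi : 'Hom(P, K^o)) (act P (alpha ^+ l ** a ** e w) u) = 0.
    by rewrite act_smul phiE -act_smul (nk_idem1 nkD) -phiE act_smul phia0.
  rewrite kE lenw actZE linearZ /= act_smul -/(socle_gen e alpha m v u) -/z ze phiz.
  by rewrite [_ *: 1]mulr1; apply/eqP.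
Qed.

(** A geometric series in the radical part: each term added to [y] raises the power of [alpha] in
    the error by one. *)
Lemma right_inverse v k b x : k != 0 -> e v ** x = x -> x = k *: e v + b ** alpha ->
  exists y, x ** y = e v.
Proof.
move=> k0 ex xE.
suff [y [c E]] : exists y c, e v = x ** y + c ** alpha ^+ m.
  by exists y; rewrite E (nk_nil nkD) smulr0 addr0.
elim: m => [|l [y [c E]]]; first by exists 0, (e v); rewrite smulr0 add0r expr0 smulr1.
have := nk_normal' nkD c 1; rewrite expr1 => -[c' cE].
exists (y + k^-1 *: (c ** alpha ^+ l)), (- k^-1 *: (b ** c')).
have bE : b ** alpha ** (c ** alpha ^+ l) = b ** c' ** alpha ^+ l.+1.
  by rewrite -(smul_exprS s) -!smulA [alpha ** (c ** _)]smulA cE -!smulA.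
have main : e v ** (c ** alpha ^+ l) = x ** (k^-1 *: (c ** alpha ^+ l))
    + (- k^-1 *: (b ** c')) ** alpha ^+ l.+1.
  rewrite smulZr smulZl scaleNr -scalerBr {1}xE smulDl smulZl bE addrK.
  by rewrite scalerA mulVf // scale1r.
transitivity (e v ** (x ** y + c ** alpha ^+ l)); first by rewrite -E (nk_idem1 nkD).
by rewrite smulDr smulA ex main smulDr addrA.
Qed.

End NakayamaDuality.

(** * Injective envelopes of simple modules and indecomposable projective modules *)

Section RightModules.
Variables (K : fieldType) (A : falgType K).
Variables (V : finType) (e : V -> A) (sigma sigma' : V -> V).
Variables (alpha : A) (m : nat).
Hypothesis nkD : nakayama RightSide e sigma sigma' alpha m.
Local Notation len := (path_length RightSide e alpha m).
Local Notation len' := (path_length LeftSide e alpha m).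
Implicit Types (M N P Q S T X I : fdmod A RightSide) (a b : A) (v w : V).

Let nkO : nakayama LeftSide e sigma' sigma alpha m := nakayama_opp nkD.

(** A functional at [v] that is nonzero on the image of [X] is nondegenerate, the extension being
    essential. It generates the dual and embeds [I] into D(A); injectivity of [I] splits this
    embedding, and freeness follows as for a projective module. *)
Lemma inj_envelope_simple v X I : simple_at e alpha v X -> is_inj_envelope X I ->
  exists phi : dual I, free_on (e v) phi.
Proof.
move=> [z [z0 gen ze za]] [injI [i [/homvP iH i0 ess]]].
have iz0 : i z != 0 by rewrite -memv_ker i0 memv0.
have [phi0 phi0z] := dual_coord iz0.
pose phi : dual I := (phi0 \o act I (e v))%VF.
have phiE x : (phi : 'Hom(I, K^o)) x = phi0 (act I (e v) x) by rewrite comp_lfunE.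
have phiz : (phi : 'Hom(I, K^o)) (i z) = 1 by rewrite phiE -iH ze.
have phie : act (dual I) (e v) phi = phi.
  by apply/lfunP => x; rewrite dualE !phiE -act_smul (nk_idem1 nkD).
have nondeg x : (forall a, (phi : 'Hom(I, K^o)) (act I a x) = 0) -> x = 0.
  move=> xn; have xU : x \in limg (orbit_map x).
    by apply/memv_imgP; exists 1; rewrite ?memvf // orbit_mapE act1E.
  apply/eqP; rewrite -memv0 -(ess (limg (orbit_map x))) //.
    move=> a y /memv_imgP[b _ ->]; rewrite orbit_mapE -act_smul -orbit_mapE.
    exact: memv_img (memvf _).
  apply/eqP; rewrite -subv0; apply/subvP => y; rewrite memv_cap => /andP[].
  case/memv_imgP => t _ yt /memv_imgP[a _ ya]; have [k tk] := gen t.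
  have := xn a; rewrite -orbit_mapE -ya yt tk !linearZ /= phiz [_ *: 1]mulr1 => ->.
  by rewrite scale0r mem0v.
have phi0' : phi != 0.
  apply/eqP => p0; move: phiz; rewrite p0 zero_lfunE => /eqP.
  by rewrite eq_sym oner_eq0.
pose J : fdmod A RightSide := dual (regular A LeftSide).
have [ka kaE] := orbit_functional_lfun (phi : 'Hom(I, K^o)).
have kaH : (ka : 'Hom(I, J)) \in homv I J.
  apply/homvP => a x; apply/lfunP => b.
  by rewrite kaE [RHS]dualE kaE act_regular -act_smul.
have ka0 : lker ka = 0%VS.
  apply/eqP; rewrite -subv0; apply/subvP => x; rewrite memv_ker => /eqP kx.
  by rewrite memv0; apply/eqP/nondeg => a; rewrite -kaE kx zero_lfunE.
have [|r rH rE] := injI I J ka \1%VF kaH ka0.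
  by apply/homvP => a x; rewrite !id_lfunE.
have rK x : r (ka x) = x by rewrite -comp_lfunE rE id_lfunE.
(* Read on the duals, the retraction [r] splits [A -> D I]; by reflexivity [x0] is the image of
   [phi] under that splitting. *)
have [x0 x0E] := bidual_eval ((phi : 'Hom(I, K^o)) \o r)%VF.
exists phi; apply: (free_of_split nkO (x0 := x0)) => // [||a phia].
- by move=> psi; apply: dual_gen.
- by apply/lfunP => x; rewrite dualE -kaE x0E comp_lfunE rK.
apply/eqP/negPn/negP => /dual_coord [om omE].
have rom : r (act J a om) = act I a (r om) by move/homvP: rH => ->.
have : (act J a om : 'Hom(A, K^o)) x0 = 0.
  by rewrite x0E comp_lfunE rom -dualE phia zero_lfunE.
rewrite (@dualE K A LeftSide (regular A LeftSide) a om x0) act_regular omE => /eqP.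
by rewrite oner_eq0.
Qed.

(** A simple quotient of [Q] at [v] lifts to a map from [Q] to [A], and its component [f] in [e_v A]
    takes a value outside the radical. Hence [e_v] is a value of [f], so [e_v A] splits off from [Q]
    and is all of it. *)
Lemma indec_projective_free Q : indecomposable Q -> projective Q ->
  exists v, exists u : Q, free_on (e v) u.
Proof.
move=> [Q0 ind] pQ.
have [x0 x00] : exists x : Q, x != 0.
  by exists (vpick fullv); rewrite vpick0.
have [la0 la0x] := dual_coord x00.
have la00 : (la0 : dual Q) != 0.
  by apply/eqP => p0; move: la0x; rewrite p0 zero_lfunE => /eqP; rewrite eq_sym oner_eq0.
(* A socle element of the left module D(Q), cut down to one vertex, amounts to a simple quotient of
   [Q]. *)
have [l [la1n la1a]] := soc_neq0 nkO la00; rewrite act_exprS in la1a.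
set la1 := act _ _ _ in la1n la1a.
have [v lav] : exists v, act (dual Q) (e v) la1 != 0.
  apply/existsP; apply: contraNT la1n; rewrite negb_exists => /forallP ev0.
  rewrite [la1](act_sum nkO) big1 // => v _; apply/eqP.
  by have := ev0 v; rewrite negbK.
exists v; pose la := act (dual Q) (e v) la1.
have lae : act (dual Q) (e v) la = la by rewrite -act_smul (nk_idem1 nkO).
have laa : act (dual Q) alpha la = 0.
  by have [b ->] := act_alphaC' nkO (e v) la1; rewrite la1a linear0.
have [S' S'v] := ex_simple nkO lav lae laa.
pose S : fdmod A RightSide := dual S'.
have [z [z0 zgen ze za]] : simple_at e alpha v S by exact: simple_dual S'v.
have laE (x : Q) a : (la : 'Hom(Q, K^o)) (act Q a x) = (act (dual Q) a la : 'Hom(Q, K^o)) x.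
  by rewrite dualE.
have [p pE] := rank_one_map (la : 'Hom(Q, K^o)) z.
have pH : (p : 'Hom(Q, S)) \in homv Q S.
  apply: (hom_criterion nkD) => [w x|x]; rewrite !pE laE [RHS]linearZ /=.
    rewrite (idem_act nkO w lae) (idem_act nkD w ze); case: eqP => // _.
    by rewrite zero_lfunE scale0r scaler0.
  by rewrite laa za zero_lfunE scale0r scaler0.
have [q0 q0E] : exists q0 : Q, (la : 'Hom(Q, K^o)) q0 = 1.
  have [q qn] : exists q : Q, (la : 'Hom(Q, K^o)) q != 0.
    have : ~~ (fullv <= lker (la : 'Hom(Q, K^o)))%VS.
      apply: contra lav => /subvP laf; apply/eqP/lfunP => x.
      by rewrite zero_lfunE; apply/eqP; rewrite -memv_ker laf ?memvf.
    by case/subvPn => q _ qn; exists q; rewrite -memv_ker.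
  exists (((la : 'Hom(Q, K^o)) q)^-1 *: q); rewrite linearZ /=.
  exact: mulVf.
have gS : limg (orbit_map z) = fullv.
  apply/vspaceP => y; rewrite memvf; have [k ->] := zgen y.
  by rewrite memvZ //; apply/memv_imgP; exists 1; rewrite ?memvf // orbit_mapE act1E.
have [t /homvP tH tE] := pQ (regular A RightSide) S (orbit_map z) p (orbit_map_hom z) gS pH.
have zt x : act S (t x) z = (la : 'Hom(Q, K^o)) x *: z.
  by rewrite -orbit_mapE -comp_lfunE tE pE.
pose f : 'Hom(Q, A) := (amull (e v) \o t)%VF.
have fE x : f x = e v * t x by rewrite comp_lfunE lfunE.
have fA a x : f (act Q a x) = f x * a.
  by rewrite !fE tH act_regular /= mulrA.
pose q1 := act Q (e v) q0.
have [k [b xE]] := nk_local nkD (f q1) v.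
have ef x : e v * f x = f x by rewrite fE mulrA [e v * e v](nk_idem1 nkD).
rewrite /= ef in xE.
(* The element [f q1] acts as the identity on [z], while the radical of [A] kills it. *)
have k1 : k != 0.
  have : act S (f q1) z = z.
    rewrite fE -[e v * _]/(smul RightSide _ _) act_smul ze zt laE lae q0E.
    exact: scale1r.
  rewrite xE actDE actZE ze -[b * _]/(smul RightSide _ _) act_smul.
  have -> : act S alpha (act S b z) = 0.
    by have [c ->] := act_alphaC' nkD b z; rewrite za linear0.
  rewrite addr0 => kz; apply: contraNneq z0 => k0.
  by rewrite -kz k0 scale0r.
have [y yE] := right_inverse nkD k1 (ef q1) xE; rewrite /= in yE.
pose u := act Q (y * e v) q1.
have fu : f u = e v by rewrite fA mulrA yE; exact: (nk_idem1 nkD).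
have ue : act Q (e v) u = u.
  by rewrite /u -act_smul /= -mulrA [e v * e v](nk_idem1 nkD).
have ann a : act Q a u = 0 -> e v * a = 0 by move=> ua; rewrite -fu -fA ua linear0.
have sub1 : submodule (limg (orbit_map u)).
  move=> a x /memv_imgP[c _ ->]; rewrite orbit_mapE -act_smul -orbit_mapE.
  exact: memv_img (memvf _).
have sub2 : submodule (lker f).
  by move=> a x; rewrite !memv_ker fA => /eqP ->; rewrite mul0r.
have dec x : x - orbit_map u (f x) \in lker f.
  by rewrite memv_ker linearB /= orbit_mapE fA fu ef subrr.
exists u; split=> //.
move=> x; exists (f x); rewrite -orbit_mapE; apply/eqP; rewrite -subr_eq0 -memv0.
(* [Q] is the direct sum of [u A] and the kernel of [f], and [u] is not zero. *)
case: (ind _ _ sub1 sub2) => [||U0|<-//].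
- apply/vspaceP => w; rewrite memvf -[w](addrNK (orbit_map u (f w))) addrC.
  by rewrite memv_add ?memv_img ?memvf.
- apply/eqP; rewrite -subv0; apply/subvP => w; rewrite memv_cap => /andP[].
  case/memv_imgP => a _ ->; rewrite orbit_mapE memv_ker fA fu => /eqP eva.
  by rewrite -ue -act_smul /= eva act0E mem0v.
have u0 : u = 0.
  apply/eqP; rewrite -memv0 -U0; apply/memv_imgP; exists 1; rewrite ?memvf //.
  by rewrite orbit_mapE act1E.
by case/eqP: (idem_neq0 nkD v); rewrite -fu u0 linear0.
Qed.

End RightModules.

(** * Lengths of nonzero paths *)

Lemma iter_cancel (T : Type) (f g : T -> T) l :
  cancel f g -> cancel (iter l f) (iter l g).
Proof. by move=> fK; elim: l => // l IH x; rewrite iterSr iterS fK IH. Qed.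

Section Combinatorics.
Variables (V : Type) (c d : V -> nat) (sigma sigma' : V -> V).

(* [c v] is the length of the longest nonzero walk from [v], plus one, and [d v]
   the same for the walks to [v]. *)
Record walk_lengths : Prop := WalkLengths {
  wl_K : cancel sigma sigma';
  wl_K' : cancel sigma' sigma;
  wl_c0 : forall v, (0 < c v)%N;
  wl_d0 : forall v, (0 < d v)%N;
  wl_cd : forall v l, (l < c v)%N = (l < d (iter l sigma v))%N;
  wl_dc : forall v l, (l < d v)%N = (l < c (iter l sigma' v))%N }.

Hypothesis wl : walk_lengths.

Lemma iter_sigmaK l v : iter l sigma (iter l sigma' v) = v.
Proof. exact/iter_cancel/(wl_K' wl). Qed.

Lemma iter_sigmaK' l v : iter l sigma' (iter l sigma v) = v.
Proof. exact/iter_cancel/(wl_K wl). Qed.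

(** The longest nonzero walk into [y] starts at [i]. If the longest one from [i] could start a step
    earlier, at g(y), it would be at least as long as the walk from g(y) to [y], which vanishes. *)
Lemma top_end_maximal y (i := sigma (iter (d y) sigma' y)) :
  d (iter (c i).-1 sigma i) = c i.
Proof.
have c0 := wl_c0 wl i; have d0 := wl_d0 wl y.
have iE : i = iter (d y).-1 sigma' y by rewrite /i -{1}(prednK d0) iterS (wl_K' wl).
have dc : (d y <= c i)%N.
  by rewrite -{1}(prednK d0) iE -(wl_dc wl) prednK.
set w := iter _ _ _; apply/eqP; rewrite eqn_leq andbC.
rewrite -{1}(prednK c0) -(wl_cd wl) prednK // leqnn andTb leqNgt (wl_dc wl).
have -> : iter (c i) sigma' w = iter (d y) sigma' y.
  by rewrite -{1}(prednK c0) iterS /w iter_sigmaK' /i (wl_K wl).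
apply/negP => lt; have := leq_ltn_trans dc lt.
by rewrite -(wl_dc wl) ltnn.
Qed.

(** The witness is the end of the longest nonzero walk from [i], which by hypothesis cannot start a
    step earlier. *)
Lemma top_end_surj i : (c (sigma' i) <= c i)%N -> exists y, sigma' i = iter (d y) sigma' y.
Proof.
move=> ci; have c0 := wl_c0 wl i; pose y := iter (c i).-1 sigma i.
have yE : iter (c i) sigma' y = sigma' i.
  by rewrite -{1}(prednK c0) iterS iter_sigmaK'.
exists y; suff -> : d y = c i by rewrite yE.
apply/eqP; rewrite eqn_leq andbC -{1}(prednK c0) -(wl_cd wl) prednK // leqnn andTb.
by rewrite leqNgt (wl_dc wl) yE -leqNgt.
Qed.

(** The walk from g(y) to [y] vanishes by the choice of d(y). One step shorter it ends at
    [sigma' y], which the longest walk from [v] reaches, so enough walks into that vertex are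
    nonzero. *)
Lemma endpoint_length v (y := iter (c v) sigma v) : c (iter (d y) sigma' y) = d y.
Proof.
have c0 := wl_c0 wl v; have d0 := wl_d0 wl y.
apply/eqP; rewrite eqn_leq leqNgt -(wl_dc wl) ltnn andTb.
have yE : sigma' y = iter (c v).-1 sigma v by rewrite /y -{1}(prednK c0) iterS (wl_K wl).
have cd : (c v <= d (sigma' y))%N by rewrite -{1}(prednK c0) yE -(wl_cd wl) prednK.
have dc : (d y <= c v)%N by rewrite leqNgt -(wl_cd wl) ltnn.
rewrite -{1}(prednK d0) (wl_cd wl).
have -> : iter (d y).-1 sigma (iter (d y) sigma' y) = sigma' y.
  by rewrite -{2}(prednK d0) iterSr iter_sigmaK.
by rewrite prednK //; exact: leq_trans cd.
Qed.

(** The identity h g h = h of a Galois connection; [walk_lengths_opp] turns it into g h g = g. *)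
Lemma endpointK v (y := iter (c v) sigma v) :
  iter (c (iter (d y) sigma' y)) sigma (iter (d y) sigma' y) = y.
Proof. by rewrite endpoint_length iter_sigmaK. Qed.

End Combinatorics.

Lemma walk_lengths_opp (V : Type) (c d : V -> nat) (sigma sigma' : V -> V) :
  walk_lengths c d sigma sigma' -> walk_lengths d c sigma' sigma.
Proof. by case=> *; split. Qed.

(** * The vertices of the socles and tops of projective-injective modules *)

Section Characterisation.
Variables (K : fieldType) (A : falgType K).
Variables (V : finType) (e : V -> A) (sigma sigma' : V -> V).
Variables (alpha : A) (m : nat).
Hypothesis nkD : nakayama RightSide e sigma sigma' alpha m.
Local Notation len := (path_length RightSide e alpha m).
Local Notation len' := (path_length LeftSide e alpha m).
Implicit Types (M N P Q S T X I : fdmod A RightSide) (a b : A) (v w : V).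

Let nkO : nakayama LeftSide e sigma' sigma alpha m := nakayama_opp nkD.

Lemma nk_walk_lengths : walk_lengths len len' sigma sigma'.
Proof.
have cd v l : (l < len v)%N = (l < len' (iter l sigma v))%N.
  by rewrite -(lenP nkD) -(lenP nkO) (nk_pow nkD) /=.
split=> //.
- exact: nk_K nkD.
- exact: nk_K' nkD.
- exact: len_gt0 nkD.
- exact: len_gt0 nkO.
move=> v l; rewrite cd; congr (_ < len' _)%N.
exact/esym/iter_cancel/(nk_K' nkD).
Qed.
Let wl := nk_walk_lengths.

(** The map h of the overview, followed by g. As [len v] exceeds the length of the longest nonzero
    path by one, [path_end v] lies one arrow beyond its end, whence [sigma w = path_end v] for the
    socle vertex [w]. *)
Definition path_end v := iter (len v) sigma v.
Definition path_start v := iter (len' v) sigma' v.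

Lemma maximal_path_proj_inj v : len' (iter (len v).-1 sigma v) = len v ->
  exists Q, exists2 u : Q, free_on (e v) u & indec_proj_inj Q.
Proof.
move=> maxv; have [Q [u fu]] := ex_free nkD v; exists Q, u => //.
have [phi fphi] := maximal_path_dual_free nkD fu erefl maxv.
split; [exact: (free_indecomposable nkD fu) | exact: free_projective fu |].
exact: dual_free_injective fphi.
Qed.

Lemma soc_of_proj_injP S : soc_of_proj_inj S ->
  exists w, simple_at e alpha w S /\ exists v, sigma w = path_end v.
Proof.
move=> [Q [indQ projQ _] socS]; have [v [u fu]] := indec_projective_free nkD indQ projQ.
exists (iter (len v).-1 sigma v); split; first exact: (free_soc nkD fu socS).
by exists v; rewrite /path_end -{2}(prednK (len_gt0 nkD v)).
Qed.

(** The projective module at [v] has the right socle but need not be injective. It is replaced by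
    the one at the start [i] of the longest nonzero path into [w]. *)
Lemma ex_soc_of_proj_inj w v : sigma w = path_end v ->
  exists S, simple_at e alpha w S /\ soc_of_proj_inj S.
Proof.
move=> wv; have wE : w = sigma' (path_end v) by rewrite -wv (nk_K nkD).
pose i := iter (len' w).-1 sigma' w.
have ci : len i = len' w.
  by rewrite /i wE; exact: (top_end_maximal (walk_lengths_opp wl) v).
have iw : iter (len i).-1 sigma i = w by rewrite ci (iter_sigmaK wl).
have [Q [u fu pQ]] : exists Q, exists2 u : Q, free_on (e i) u & indec_proj_inj Q.
  by apply: maximal_path_proj_inj; rewrite iw.
have [S Sw] : exists S, simple_at e alpha w S.
  apply: (ex_simple nkD (socle_gen_neq0 nkD fu)); last exact: (socle_gen_ker nkD fu).
  by rewrite -{1}iw; exact: (socle_gen_idem nkD fu).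
exists S; split=> //; exists Q => //; apply: (simple_is_soc nkD fu).
by rewrite iw.
Qed.

Lemma top_of_proj_injP T : top_of_proj_inj T ->
  exists i, simple_at e alpha i T /\ exists y, sigma' i = path_start y.
Proof.
move=> [Q [indQ projQ injQ] topT]; have [v [u fu]] := indec_projective_free nkD indQ projQ.
exists v; split; first exact: (free_top nkD fu topT).
apply: (top_end_surj wl); rewrite leqNgt -(lenP nkD) negbK.
exact/eqP/(free_injective_inv nkD fu injQ).
Qed.

Lemma ex_top_of_proj_inj i y : sigma' i = path_start y ->
  exists T, simple_at e alpha i T /\ top_of_proj_inj T.
Proof.
move=> iy; have iE : i = sigma (path_start y) by rewrite -iy (nk_K' nkD).
have di : len' (iter (len i).-1 sigma i) = len i.
  by rewrite iE; exact: (top_end_maximal wl y).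
have [Q [u fu pQ]] := maximal_path_proj_inj di.
have [T Ti] : exists T, simple_at e alpha i T.
  (* The simple module at [i] is obtained as the dual of a left one: the maximal path from [i] spans
     a simple left submodule of [A], since [alpha] kills it from the left. *)
  pose z : regular A LeftSide := e i * alpha ^+ (len i).-1.
  have zE : z = alpha ^+ (len i).-1 * e (iter (len i).-1 sigma i).
    exact: (nk_pow nkD i (len i).-1).
  have [|||S' S'i] := ex_simple (M := regular A LeftSide) (z := z) (v := i) nkO.
  - by rewrite [z == 0](_ : _ = (smul RightSide (e i) (alpha ^+ (len i).-1) == 0)) //
      (lenP nkD) prednK ?(len_gt0 nkD).
  - by rewrite act_regular /= /z mulrA [e i * e i](nk_idem1 nkD).
  - rewrite act_regular /= zE mulrA -exprS prednK ?(len_gt0 nkD) // -{1}di.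
    exact: (len_nil nkO).
  by exists (dual S'); exact: simple_dual S'i.
by exists T; split=> //; exists Q => //; exact: (simple_is_top nkD fu Ti).
Qed.

End Characterisation.

(** * Endomorphism algebras as corners *)

Section Corners.
Variables (K : fieldType) (A : falgType K).

Definition is_corner (E : algType K) (e0 : A) : Prop :=
  exists theta : {linear E -> A}, [/\ injective theta,
    forall a, (e0 * a = a /\ a * e0 = a) <-> exists x, theta x = a
    & forall x y, theta (x * y) = theta x * theta y].

(** An endomorphism sends [u] to [u a] with [a] in [e0 A], and [u = u e0] forces [a] into the
    corner. Composition corresponds to the product in the same order because [M] is a right
    module. *)
Lemma End_corner (M : fdmod A RightSide) e0 (u : M) (E : algType K) :
  free_on e0 u -> is_End_algebra M E -> is_corner E e0.
Proof.
move=> fM [phi [phi_inj phi_im _ phiM]]; have [ue gen ann] := fM.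
have ee : e0 * e0 = e0 by exact: free_idempotent fM.
have phiH x a y : phi x (act M a y) = act M a (phi x y).
  by have /homvP := proj2 (phi_im (phi x)) (ex_intro _ x erefl); apply.
have actA a b x : act M (a * b) x = act M b (act M a x).
  exact: (act_smul (s := RightSide)).
pose sec := (orbit_map u)^-1%VF.
have secE y : act M (sec y) u = y.
  have [a ->] := gen y; rewrite -[LHS]orbit_mapE -orbit_mapE limg_lfunVK //.
  exact: memv_img (memvf _).
pose th x := e0 * sec (phi x u).
have thE x : act M (th x) u = phi x u by rewrite actA ue secE.
have lin : linear th.
  by move=> k x y; rewrite /th linearP /= add_lfunE scale_lfunE linearP mulrDr scalerAr.
pose L : {linear E -> A} := HB.pack th (GRing.isLinear.Build _ _ _ _ th lin).
have e0th x : e0 * th x = th x by rewrite /th mulrA ee.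
have uniq a b : e0 * a = a -> e0 * b = b -> act M a u = act M b u -> a = b.
  move=> ea eb ab; apply/eqP; rewrite -subr_eq0 -{1}ea -{1}eb -mulrBr.
  by apply/eqP; apply: (ann (a - b)); rewrite actBE ab subrr.
exists L; have LE x : L x = th x by [].
split=> [x y|a|x y]; rewrite ?LE.
- move=> xy; apply: phi_inj; apply: (free_hom_ext fM).
  + by apply/(proj2 (phi_im _)); exists x.
  + by apply/(proj2 (phi_im _)); exists y.
  + by rewrite -!thE xy.
- split=> [[ea ae]|[x <-]]; last first.
    rewrite LE; split; first exact: e0th.
    apply: uniq (e0th x) _; first by rewrite mulrA [e0 * _]e0th.
    by rewrite actA thE -phiH ue.
  have [|f fH fu] := free_lift (M := M) (x := act M a u) fM.
    by rewrite -actA ae.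
  have [x xE] := proj1 (phi_im f) fH; exists x.
  by rewrite LE; apply: (uniq _ _ (e0th x) ea); rewrite thE xE fu.
- apply: (uniq _ _ (e0th _)); first by rewrite mulrA e0th.
  by rewrite thE phiM comp_lfunE actA !thE -phiH thE.
Qed.

Lemma dual_homP (M : fdmod A RightSide) (f : 'End(M)) :
  f \in endv M -> forall (psi : dual M) a,
  act (dual M) a ((psi : 'Hom(M, K^o)) \o f)%VF
  = ((act (dual M) a psi : 'Hom(M, K^o)) \o f)%VF.
Proof.
move=> /homvP fH psi a; apply/lfunP => x.
by rewrite dualE [RHS]comp_lfunE dualE comp_lfunE fH.
Qed.

(** Here [f] corresponds to the [a] with [phi \o f = a phi]. Transposition reverses the order and
    the left action on the dual reverses it again, so no opposite algebra appears. *)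
Lemma dual_End_corner (M : fdmod A RightSide) e0 (phi : dual M) (H : algType K) :
  free_on e0 phi -> is_End_algebra M H -> is_corner H e0.
Proof.
move=> fM [Phi [Phi_inj Phi_im _ PhiM]]; have [phie gen ann] := fM.
have ee : e0 * e0 = e0 by exact: free_idempotent fM.
have PhiE x : Phi x \in endv M by apply/(proj2 (Phi_im _)); exists x.
have actA a b (psi : dual M) :
    act (dual M) (a * b) psi = act (dual M) a (act (dual M) b psi).
  exact: (act_smul (s := LeftSide)).
pose sec := (orbit_map phi)^-1%VF.
have secE psi : act (dual M) (sec psi) phi = psi.
  have [a ->] := gen psi; rewrite -[LHS]orbit_mapE -orbit_mapE limg_lfunVK //.
  exact: memv_img (memvf _).
pose pb x : dual M := ((phi : 'Hom(M, K^o)) \o Phi x)%VF.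
have pb_lin : linear pb.
  by move=> k x y; rewrite /pb linearP /= comp_lfunDr comp_lfunZr.
pose th x := sec (pb x) * e0.
have thE x : act (dual M) (th x) phi = pb x by rewrite actA phie secE.
have lin : linear th.
  by move=> k x y; rewrite /th pb_lin linearP mulrDl scalerAl.
pose L : {linear H -> A} := HB.pack th (GRing.isLinear.Build _ _ _ _ th lin).
have the0 x : th x * e0 = th x by rewrite /th -mulrA ee.
have uniq a b : a * e0 = a -> b * e0 = b ->
    act (dual M) a phi = act (dual M) b phi -> a = b.
  move=> ae be ab; apply/eqP; rewrite -subr_eq0 -{1}ae -{1}be -mulrBl.
  by apply/eqP; apply: (ann (a - b)); rewrite actBE ab subrr.
(* Since [phi] generates the dual, [phi \o f] determines every [psi \o f], and functionals separate
   points. *)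
have inj (f g : 'End(M)) : f \in endv M -> g \in endv M ->
    ((phi : 'Hom(M, K^o)) \o f)%VF = ((phi : 'Hom(M, K^o)) \o g)%VF -> f = g.
  move=> fH gH fg; apply/lfunP => x; apply/eqP; rewrite -subr_eq0; apply/negPn/negP.
  move=> /dual_coord [psi]; have [a ->] := gen psi.
  rewrite linearB /= -!comp_lfunE -!dual_homP // fg subrr => /eqP.
  by rewrite eq_sym oner_eq0.
exists L; have LE x : L x = th x by [].
split=> [x y|a|x y]; rewrite ?LE.
- move=> xy; apply: Phi_inj; apply: inj => //.
  by rewrite -[LHS]/(pb x) -[RHS]/(pb y) -!thE xy.
- split=> [[ea ae]|[x <-]]; last first.
    rewrite LE; split; last exact: the0.
    apply: (uniq _ _ _ (the0 x)); first by rewrite -mulrA the0.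
    by rewrite actA thE dual_homP // phie.
  have [|F /homvP FH Fphi] := free_lift (M := dual M) (x := act (dual M) a phi) fM.
    by rewrite -actA ea.
  (* [F] is an endomorphism of the dual module; the endomorphism of [M] sought is the map whose
     transpose is [F]. *)
  have [f fE] := adjoint_map F.
  have fH : f \in endv M.
    apply/homvP => b x; apply/eqP; rewrite -subr_eq0; apply/negPn/negP.
    move=> /dual_coord [psi].
    rewrite linearB /= fE -(dualE b psi (f x)) fE FH dualE subrr => /eqP.
    by rewrite eq_sym oner_eq0.
  have [x xE] := proj1 (Phi_im f) fH; exists x.
  rewrite LE; apply: (uniq _ _ (the0 x) ae); rewrite thE /pb xE -Fphi.
  by apply/lfunP => y; rewrite comp_lfunE fE.
- apply: (uniq _ _ (the0 _)); first by rewrite -mulrA the0.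
  rewrite thE actA thE dual_homP // thE /pb PhiM.
  exact: comp_lfunA.
Qed.

End Corners.

(** * Freeness of direct sums and of their duals *)

Section Sums.
Variables (K : fieldType) (A : falgType K).

Lemma mod_sumE s (M N : fdmod A s) a (x : M) (y : N) :
  act (mod_sum M N) a (x, y) = (act M a x, act N a y).
Proof.
pose L : {linear (M * N)%type -> (M * N)%type} := HB.pack
  (fun z : M * N => (act M a z.1, act N a z.2))
  (GRing.isLinear.Build _ _ _ _ _ (@mod_sum_act_fun_is_linear K A s M N a)).
by rewrite -[act _ _ _]/(linfun L (x, y)) lfunE.
Qed.

Lemma mod_sum_free s (M N : fdmod A s) e0 e1 (x : M) (y : N) :
  smul s e0 e1 = 0 -> smul s e1 e0 = 0 -> free_on e0 x -> free_on e1 y ->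
  free_on (e0 + e1) ((x, y) : mod_sum M N).
Proof.
move=> e01 e10 [xe genx annx] [ye geny anny].
have xe1 : act M e1 x = 0 by rewrite -xe -act_smul e01 act0E.
have ye0 : act N e0 y = 0 by rewrite -ye -act_smul e10 act0E.
split.
- by rewrite mod_sumE !actDE xe ye xe1 ye0 addr0 add0r.
- move=> [x' y']; have [[a ->] [b ->]] := (genx x', geny y').
  exists (smul s e0 a + smul s e1 b).
  by rewrite mod_sumE !actDE !act_smul xe ye xe1 ye0 !linear0 addr0 add0r.
- move=> a; rewrite mod_sumE => -[xa ya].
  by rewrite smulDl annx // anny // addr0.
Qed.

(** The generator is [phi] on the first summand plus [psi] on the second; orthogonality of the
    idempotents keeps the two orbits apart. *)
Lemma dual_mod_sum_free s (M N : fdmod A s) e0 e1 (phi : dual M) (psi : dual N) :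
  smul s e0 e1 = 0 -> smul s e1 e0 = 0 -> free_on e0 phi -> free_on e1 psi ->
  exists chi : dual (mod_sum M N), free_on (e0 + e1) chi.
Proof.
move=> e01 e10 [phie genphi annphi] [psie genpsi annpsi].
have lin : linear (fun z : mod_sum M N =>
    (phi : 'Hom(M, K^o)) z.1 + (psi : 'Hom(N, K^o)) z.2).
  by move=> k z t; rewrite /= !linearP /= scalerDr addrACA.
pose L : {linear mod_sum M N -> K^o} := HB.pack
  (fun z : mod_sum M N => (phi : 'Hom(M, K^o)) z.1 + (psi : 'Hom(N, K^o)) z.2)
  (GRing.isLinear.Build _ _ _ _ _ lin).
pose chi : dual (mod_sum M N) := linfun L.
have chiE a x y : (act (dual (mod_sum M N)) a chi : 'Hom(_, K^o)) (x, y) =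
    (act (dual M) a phi : 'Hom(M, K^o)) x + (act (dual N) a psi : 'Hom(N, K^o)) y.
  by rewrite !dualE mod_sumE lfunE.
have chi1 x y : (chi : 'Hom(mod_sum M N, K^o)) (x, y)
    = (phi : 'Hom(M, K^o)) x + (psi : 'Hom(N, K^o)) y by rewrite lfunE.
have ext (F G : dual (mod_sum M N)) : (forall x y,
   (F : 'Hom(mod_sum M N, K^o)) (x, y) = (G : 'Hom(mod_sum M N, K^o)) (x, y)) -> F = G.
  by move=> FG; apply/lfunP => -[x y]; exact: FG.
have phi1 : act (dual M) e1 phi = 0.
  by rewrite -phie -act_smul smul_opp e10 act0E.
have psi0 : act (dual N) e0 psi = 0.
  by rewrite -psie -act_smul smul_opp e01 act0E.
exists chi; split.
- by apply: ext => x y; rewrite chiE !actDE phie psie phi1 psi0 addr0 add0r chi1.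
- move=> F.
  have lin1 : linear (fun x : M => (F : 'Hom(mod_sum M N, K^o)) (x, 0)).
    move=> k x y; rewrite -linearP; congr (fun_of_lfun _ _).
    by congr pair; rewrite /= scaler0 addr0.
  have lin2 : linear (fun y : N => (F : 'Hom(mod_sum M N, K^o)) (0, y)).
    move=> k x y; rewrite -linearP; congr (fun_of_lfun _ _).
    by congr pair; rewrite /= scaler0 addr0.
  pose L1 : {linear M -> K^o} := HB.pack
    (fun x : M => (F : 'Hom(mod_sum M N, K^o)) (x, 0))
    (GRing.isLinear.Build _ _ _ _ _ lin1).
  pose L2 : {linear N -> K^o} := HB.pack
    (fun y : N => (F : 'Hom(mod_sum M N, K^o)) (0, y))
    (GRing.isLinear.Build _ _ _ _ _ lin2).
  have [[a aE] [b bE]] := (genphi (linfun L1), genpsi (linfun L2)).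
  exists (smul (opp_side s) e0 a + smul (opp_side s) e1 b).
  apply: ext => x y; rewrite chiE !actDE !act_smul phie psie phi1 psi0 !linear0.
  rewrite addr0 add0r -aE -bE !lfunE /= -linearD; congr (fun_of_lfun _ _).
  by congr pair; rewrite /= ?addr0 ?add0r.
- move=> a chia; have [pa qa] : act (dual M) a phi = 0 /\ act (dual N) a psi = 0.
    split; apply/lfunP => x; rewrite zero_lfunE.
      by have := chiE a x 0; rewrite chia zero_lfunE linear0 addr0.
    by have := chiE a 0 x; rewrite chia zero_lfunE linear0 add0r.
  by rewrite smulDl annphi // annpsi // addr0.
Qed.

Lemma mod0_free s : free_on 0 (0 : mod0 A s).
Proof.
split=> [|x|a _]; first by rewrite linear0.
  by exists 0; rewrite linear0 [LHS]thinmx0.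
exact: smul0r.
Qed.

Lemma dual_mod0_free s : free_on 0 (0 : dual (mod0 A s)).
Proof.
split=> [|f|a _]; first by rewrite linear0.
  by exists 0; rewrite linear0; apply/lfunP => x; rewrite [x]thinmx0 !linear0.
exact: smul0r.
Qed.

Section BigSum.
Variables (s : side) (V : finType) (e : V -> A).
Hypothesis idem : forall v w, smul s (e v) (e w) = if v == w then e v else 0.

Lemma sum_idem_orth k (v : 'I_k.+1 -> V) : injective v ->
  smul s (e (v ord0)) (\sum_(i < k) e (v (lift ord0 i))) = 0 /\
  smul s (\sum_(i < k) e (v (lift ord0 i))) (e (v ord0)) = 0.
Proof.
move=> vinj; split.
  rewrite (big_morph (smul s (e (v ord0))) (id1 := 0) (op1 := +%R)); last 2 first.
  - by move=> a b; rewrite smulDr.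
  - exact: smulr0.
  by rewrite big1 // => i _; rewrite idem (inj_eq vinj) (negbTE (neq_lift _ _)).
rewrite (big_morph (smul s ^~ (e (v ord0))) (id1 := 0) (op1 := +%R)); last 2 first.
- by move=> a b; rewrite smulDl.
- exact: smul0r.
by rewrite big1 // => i _; rewrite idem (inj_eq vinj) eq_sym (negbTE (neq_lift _ _)).
Qed.

Lemma mod_bigsum_free k (M : 'I_k -> fdmod A s) (v : 'I_k -> V) : injective v ->
  (forall i, exists u : M i, free_on (e (v i)) u) ->
  exists u : mod_bigsum M, free_on (\sum_i e (v i)) u.
Proof.
rewrite /mod_bigsum; elim: k M v => [|k IH] M v vinj Mfree.
  by rewrite !big_ord0; exists 0; exact: mod0_free.
rewrite !big_ord_recl.
have [|u fu] := IH (fun i => M (lift ord0 i)) (fun i => v (lift ord0 i))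
  _ (fun i => Mfree _).
  by move=> i j /vinj /lift_inj.
have [u0 fu0] := Mfree ord0; have [o1 o2] := sum_idem_orth vinj.
by exists (u0, u); apply: mod_sum_free.
Qed.

Lemma dual_mod_bigsum_free k (M : 'I_k -> fdmod A s) (v : 'I_k -> V) : injective v ->
  (forall i, exists u : dual (M i), free_on (e (v i)) u) ->
  exists u : dual (mod_bigsum M), free_on (\sum_i e (v i)) u.
Proof.
rewrite /mod_bigsum; elim: k M v => [|k IH] M v vinj Mfree.
  by rewrite !big_ord0; exists 0; exact: dual_mod0_free.
rewrite !big_ord_recl.
have [|u fu] := IH (fun i => M (lift ord0 i)) (fun i => v (lift ord0 i))
  _ (fun i => Mfree _).
  by move=> i j /vinj /lift_inj.
have [u0 fu0] := Mfree ord0; have [o1 o2] := sum_idem_orth vinj.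
exact: dual_mod_sum_free o1 o2 fu0 fu.
Qed.

End BigSum.
End Sums.

(** * The isomorphism between the corners *)

Section WalkShift.
Variables (V : Type) (c d : V -> nat) (sigma sigma' : V -> V).
Hypothesis wl : walk_lengths c d sigma sigma'.

(** Monotonicity of g on the universal cover: a nonzero walk of length [l + d v] through [v] would
    contain the vanishing walk from g(v) to [v]. It makes the subtraction in [start_shift] a true
    difference. *)
Lemma wl_step v l : (d (iter l sigma v) <= l + d v)%N.
Proof.
rewrite leqNgt (wl_dc wl) addnC iterD (iter_sigmaK' wl).
apply/negP => lt; have : (d v < c (iter (d v) sigma' v))%N.
  exact: leq_ltn_trans (leq_addr _ _) lt.
by rewrite -(wl_dc wl) ltnn.
Qed.

Lemma wl_step' v l : (c v <= l + c (iter l sigma v))%N.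
Proof.
rewrite leqNgt (wl_cd wl) addnC iterD; apply/negP => lt.
have : (c (iter l sigma v) < d (iter (c (iter l sigma v)) sigma (iter l sigma v)))%N.
  exact: leq_ltn_trans (leq_addr _ _) lt.
by rewrite -(wl_cd wl) ltnn.
Qed.

Lemma start_shift v l (v' := iter l sigma v) :
  iter (l + d v - d v') sigma (iter (d v) sigma' v) = iter (d v') sigma' v'.
Proof.
rewrite -[LHS](iter_sigmaK' wl (d v')) -iterD subnKC ?wl_step //.
by rewrite iterD (iter_sigmaK wl).
Qed.

Lemma end_shift v l (v' := iter l sigma v) :
  iter (l + c v' - c v) sigma (iter (c v) sigma v) = iter (c v') sigma v'.
Proof. by rewrite -iterD subnK ?wl_step' // addnC iterD. Qed.

End WalkShift.

(** * The nonzero paths as a basis *)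

Section Shift.
Variables (K : fieldType) (A : falgType K).
Variables (V : finType) (e : V -> A) (sigma sigma' : V -> V).
Variables (alpha : A) (m : nat).
Hypothesis nkD : nakayama RightSide e sigma sigma' alpha m.
Local Notation c := (path_length RightSide e alpha m).
Local Notation b v l := (e v * alpha ^+ l).
Implicit Types (v w : V).

Lemma path_neq0 v l : (b v l != 0) = (l < c v)%N.
Proof. exact: (lenP nkD v l). Qed.

Lemma path_eq0 v l : (c v <= l)%N -> b v l = 0.
Proof. by rewrite leqNgt -path_neq0 negbK => /eqP. Qed.

Lemma idemM v w : e v * e w = if v == w then e v else 0.
Proof. exact: (nk_idem nkD v w). Qed.

Lemma path_comm v l : b v l = alpha ^+ l * e (iter l sigma v).
Proof. exact: (nk_pow nkD v l). Qed.

Lemma path_mulM v l w k :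
  b v l * b w k = if iter l sigma v == w then b v (l + k) else 0.
Proof.
rewrite {1}path_comm -mulrA [e _ * (e w * _)]mulrA idemM.
case: eqP => _; last by rewrite mul0r mulr0.
by rewrite mulrA -path_comm exprD mulrA.
Qed.

(** Induction on the length of the path. Multiplying the relation by [e v] on the left and by the
    power of [alpha] that completes the path to a maximal one kills all longer paths from [v] and
    all paths from elsewhere; the shorter ones have zero coefficient by induction. *)
Lemma path_free (D := [pred p : V * 'I_m | (p.2 < c p.1)%N]) :
  free [tuple b (enum_val i).1 (enum_val i).2 | i < #|D|].
Proof.
apply/freeP => k; under eq_bigr do rewrite -tnth_nth tnth_mktuple.
move=> k0 i; move: {2}(nat_of_ord _) (erefl (nat_of_ord (enum_val i).2)) => l.
elim/ltn_ind: l i => l IH i il; set v := (enum_val i).1.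
have lc : (l < c v)%N by have := enum_valP i; rewrite inE -il.
have lc1 : (l <= (c v).-1)%N by rewrite -ltnS prednK ?(len_gt0 nkD).
have := congr1 (fun a => e v * a * alpha ^+ ((c v).-1 - l)) k0.
rewrite mulr0 mul0r mulr_sumr mulr_suml (bigD1 i) //= big1 => [|j ji].
  rewrite addr0 -scalerAr -scalerAl mulrA idemM eqxx il -mulrA -exprD.
  rewrite (subnKC lc1) => /eqP; rewrite scaler_eq0.
  rewrite (negPf (_ : b v (c v).-1 != 0)) ?orbF => [/eqP //|].
  by rewrite path_neq0 prednK ?(len_gt0 nkD).
rewrite -scalerAr -scalerAl mulrA idemM; case: eqP => [vj|_]; last first.
  by rewrite !mul0r scaler0.
have [lt|gt|jl] := ltngtP (enum_val j).2 l.
- by rewrite (IH _ lt j erefl) scale0r.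
- rewrite vj -mulrA -exprD path_eq0 ?scaler0 // -vj.
  by rewrite -(prednK (len_gt0 nkD v)) -{1}(subnKC lc1) -addSn leq_add2r.
- case/eqP: ji; apply: enum_val_inj.
  rewrite [LHS]surjective_pairing [RHS]surjective_pairing.
  by rewrite -vj; congr pair; apply: val_inj; rewrite /= jl.
Qed.

Lemma path_map (F : V -> nat -> A) : (forall v l, (c v <= l)%N -> F v l = 0) ->
  exists f : {linear A -> A}, forall v l, f (b v l) = F v l.
Proof.
move=> F0; pose D := [pred p : V * 'I_m | (p.2 < c p.1)%N].
pose fX := [tuple F (enum_val i).1 (enum_val i).2 | i < #|D|].
have [f /(_ path_free) fE] := linear_of_free
  [tuple b (enum_val i).1 (enum_val i).2 | i < #|D|] fX.
exists f => v l; have [lt|le] := ltnP l (c v); last by rewrite path_eq0 // F0 // linear0.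
(* Nonzero paths are shorter than [m], so the finite index set [D] misses none. *)
have lm : (l < m)%N.
  rewrite ltnNge; apply/negP => ml; move: lt; rewrite -path_neq0 => /eqP; apply.
  by rewrite -(subnKC ml) exprD (nk_nil nkD) mul0r mulr0.
have pD : (v, Ordinal lm) \in D by rewrite inE.
have := fE _; rewrite !size_tuple => /(_ erefl).
move=> /(congr1 (fun s => nth 0 s (enum_rank_in pD (v, Ordinal lm)))).
rewrite (nth_map 0) ?size_tuple // -!tnth_nth !tnth_mktuple.
by rewrite enum_rankK_in.
Qed.

End Shift.

(** * Transport between the corners at the ends and at the starts *)

Section CornerIso.
Variables (K : fieldType) (A : falgType K).
Variables (V : finType) (e : V -> A) (sigma sigma' : V -> V).
Variables (alpha : A) (m : nat).
Hypothesis nkD : nakayama RightSide e sigma sigma' alpha m.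
Local Notation c := (path_length RightSide e alpha m).
Local Notation d := (path_length LeftSide e alpha m).
Local Notation b v l := (e v * alpha ^+ l).
Local Notation h := (path_end e sigma alpha m).
Local Notation g := (path_start e sigma' alpha m).
Implicit Types (v w x y : V) (W : {set V}).

Let wl := nk_walk_lengths nkD.

Definition idem_sum W : A := \sum_(v in W) e v.
Definition ends : {set V} := [set h v | v in V].
Definition starts : {set V} := [set g v | v in V].

Lemma endsP v : v \in ends -> c (g v) = d v /\ h (g v) = v.
Proof.
case/imsetP => w _ ->; split; first exact: endpoint_length wl w.
exact: endpointK wl w.
Qed.

Lemma startsP v : v \in starts -> d (h v) = c v /\ g (h v) = v.
Proof.
case/imsetP => w _ ->; split; first exact: endpoint_length (walk_lengths_opp wl) w.
exact: endpointK (walk_lengths_opp wl) w.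
Qed.

Lemma idem_sum_path W v l : idem_sum W * b v l = if v \in W then b v l else 0.
Proof.
rewrite mulr_suml; case: ifP => vW; last first.
  rewrite big1 // => w wW; rewrite mulrA (idemM nkD); case: eqP => [wv|]; rewrite ?mul0r //.
  by rewrite -wv wW in vW.
rewrite (bigD1 v) //= big1 ?addr0 => [|w /andP[_ wv]].
  by rewrite mulrA (idemM nkD) eqxx.
by rewrite mulrA (idemM nkD) (negbTE wv) mul0r.
Qed.

Lemma path_idem_sum W v l :
  b v l * idem_sum W = if iter l sigma v \in W then b v l else 0.
Proof.
rewrite (path_comm nkD); move: (iter l sigma v) => u; rewrite -mulrA.
have := idem_sum_path W u 0; rewrite !expr0 !mulr1 => E.
have -> : e u * idem_sum W = if u \in W then e u else 0.
  rewrite mulr_sumr; case: ifP => uW; last first.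
    rewrite big1 // => w wW; rewrite (idemM nkD); case: eqP => [uw|//].
    by rewrite uw wW in uW.
  rewrite (bigD1 u) //= big1 ?addr0 => [|w /andP[_ wu]]; rewrite (idemM nkD) ?eqxx //.
  by rewrite eq_sym (negbTE wu).
by case: ifP; rewrite ?mulr0.
Qed.

(* The path from [g v] to [g w] has length [l + d v - d w] if the one from [v]
   to [w] has length [l]. *)
Lemma shift_to_starts : exists f : {linear A -> A}, forall v l, f (b v l) =
  if (v \in ends) && (iter l sigma v \in ends)
  then b (g v) (l + d v - d (iter l sigma v)) else 0.
Proof.
apply: (path_map nkD) => v l cl; case: ifP => // /andP[vh vh'].
(* A vanishing path must go to a vanishing path: with [c (g v) = d v], this reduces to [d v' <= l]
   for its end [v']. *)
apply: (path_eq0 nkD); have [-> _] := endsP vh.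
have : (d (iter l sigma v) <= l)%N by rewrite leqNgt -(wl_cd wl) -leqNgt.
by move=> dl; rewrite addnC -addnBA // leq_addr.
Qed.

Lemma shift_to_ends : exists f : {linear A -> A}, forall v l, f (b v l) =
  if (v \in starts) && (iter l sigma v \in starts)
  then b (h v) (l + c (iter l sigma v) - c v) else 0.
Proof.
apply: (path_map nkD) => v l cl; case: ifP => // /andP[vg vg'].
(* Vanishing is tested at the end of the shifted path, where [d (h v') = c v']. *)
apply: (path_eq0 nkD); rewrite leqNgt (wl_cd wl) (end_shift wl).
have [-> _] := startsP vg'; rewrite -leqNgt addnC -addnBA //.
exact: leq_addr.
Qed.

Lemma path_start_inj : {in ends &, injective g}.
Proof. by move=> v w /endsP[_ {2}<-] /endsP[_ {2}<-] ->. Qed.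

Lemma mem_starts v : g v \in starts. Proof. exact: imset_f. Qed.
Lemma mem_ends v : h v \in ends. Proof. exact: imset_f. Qed.

(** Both maps compress to their corner, so each composite is multiplication by the idempotent on
    both sides. The idempotent between [a] and [a'] discards the products of paths that meet outside
    im h, where [f] is zero on each factor. *)
Lemma corner_transport : exists f f' : {linear A -> A},
  [/\ forall a, f' (f a) = idem_sum ends * a * idem_sum ends,
      forall a, f (f' a) = idem_sum starts * a * idem_sum starts,
      forall a, idem_sum starts * f a = f a /\ f a * idem_sum starts = f a,
      forall a, idem_sum ends * f' a = f' a /\ f' a * idem_sum ends = f' a
    & forall a a', f (a * idem_sum ends * a') = f a * f a'].
Proof.
have [f fE] := shift_to_starts; have [f' f'E] := shift_to_ends.
have s1 v l := start_shift wl v l; have s2 v l := end_shift wl v l.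
exists f, f'; split.
- apply: (nk_ind nkD) => [|k a a' Ha Ha'|v l].
  + by rewrite !linear0 mulr0 mul0r.
  + by rewrite !linearP /= Ha Ha' mulrDr mulrDl -scalerAr -scalerAl.
  rewrite idem_sum_path fE; case: ifP => [/andP[vh vh']|H]; last first.
    rewrite linear0; case: ifP => vh; last by rewrite mul0r.
    by rewrite vh /= in H; rewrite path_idem_sum H.
  rewrite vh path_idem_sum vh' f'E s1 !mem_starts /=.
  have [cv ->] := endsP vh; have [-> _] := endsP vh'.
  by rewrite cv subnK ?(wl_step wl) // addnK.
- apply: (nk_ind nkD) => [|k a a' Ha Ha'|v l].
  + by rewrite !linear0 mulr0 mul0r.
  + by rewrite !linearP /= Ha Ha' mulrDr mulrDl -scalerAr -scalerAl.
  rewrite idem_sum_path f'E; case: ifP => [/andP[vh vh']|H]; last first.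
    rewrite linear0; case: ifP => vh; last by rewrite mul0r.
    by rewrite vh /= in H; rewrite path_idem_sum H.
  rewrite vh path_idem_sum vh' fE s2 !mem_ends /=.
  have [dv ->] := startsP vh; have [-> _] := startsP vh'.
  by rewrite dv subnK ?(wl_step' wl) // addnK.
- apply: (nk_ind nkD) => [|k a a' [Ha1 Ha2] [Hb1 Hb2]|v l].
  + by rewrite !linear0 mulr0 mul0r.
  + rewrite !linearP /= mulrDr mulrDl -scalerAr -scalerAl.
    by rewrite Ha1 Ha2 Hb1 Hb2.
  rewrite fE; case: ifP => [/andP[vh vh']|_]; last by rewrite mulr0 mul0r.
  by rewrite idem_sum_path path_idem_sum s1 !mem_starts.
- apply: (nk_ind nkD) => [|k a a' [Ha1 Ha2] [Hb1 Hb2]|v l].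
  + by rewrite !linear0 mulr0 mul0r.
  + rewrite !linearP /= mulrDr mulrDl -scalerAr -scalerAl.
    by rewrite Ha1 Ha2 Hb1 Hb2.
  rewrite f'E; case: ifP => [/andP[vh vh']|_]; last by rewrite mulr0 mul0r.
  by rewrite idem_sum_path path_idem_sum s2 !mem_ends.
- move=> a a'; elim/(nk_ind nkD): a => [|k a1 a2 H1 H2|v l].
  + by rewrite !mul0r !linear0 mul0r.
  + by rewrite !mulrDl -!scalerAl !linearP /= H1 H2 mulrDl -scalerAl.
  elim/(nk_ind nkD): a' => [|k a1 a2 H1 H2|w j].
  + by rewrite !mulr0 !linear0 mulr0.
  + by rewrite !mulrDr -!scalerAr !linearP /= H1 H2 mulrDr -scalerAr.
  rewrite path_idem_sum !fE; case: ifP => [vh'|_]; last by rewrite andbF !mul0r linear0.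
  rewrite andbT (path_mulM nkD); have [vw|vw] := eqVneq (iter l sigma v) w.
    rewrite -vw vh' fE -iterD [(j + l)%N]addnC; case: ifP => [/andP[vh vjh]|H].
      (* The shifts add up: [d] at the middle vertex cancels, both differences being true ones by
         [wl_step]. *)
      rewrite vh vjh (path_mulM nkD) s1 eqxx; congr (b _ _).
      have := wl_step wl v l; have := wl_step wl (iter l sigma v) j.
      by rewrite -iterD [(j + l)%N]addnC; lia.
    by case: (v \in ends) H => /= [->|_]; rewrite ?mulr0 ?mul0r.
  rewrite linear0; case: ifP => // vh; last by rewrite mul0r.
  case: ifP => [/andP[wh wjh]|_]; last by rewrite mulr0.
  (* Paths that do not compose stay so after the shift, because g is injective on im h. *)
  rewrite (path_mulM nkD) s1; case: eqP => // gE.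
  by case/eqP: vw; apply: path_start_inj.
Qed.

End CornerIso.

Lemma corner_algebra_iso (K : fieldType) (A : falgType K) (e0 e1 : A)
    (f f' : {linear A -> A}) (E G : algType K) :
  (forall a, f' (f a) = e0 * a * e0) -> (forall a, f (f' a) = e1 * a * e1) ->
  (forall a, e1 * f a = f a /\ f a * e1 = f a) ->
  (forall a, e0 * f' a = f' a /\ f' a * e0 = f' a) ->
  (forall a a', f (a * e0 * a') = f a * f a') ->
  is_corner E e0 -> is_corner G e1 -> algebra_iso E G.
Proof.
move=> f'f ff' fc f'c fM [t [t_inj t_im tM]] [r [r_inj r_im rM]].
have tc x : e0 * t x = t x /\ t x * e0 = t x by apply/t_im; exists x.
have rc x : e1 * r x = r x /\ r x * e1 = r x by apply/r_im; exists x.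
have ex x : exists y, r y == f (t x).
  by have [y yE] := proj1 (r_im _) (fc (t x)); exists y; rewrite yE.
pose psi x := xchoose (ex x).
have psiE x : r (psi x) = f (t x) by apply/eqP; exact: (xchooseP (ex x)).
have psi_surj y : exists x, psi x = y.
  have [x xE] := proj1 (t_im _) (f'c (r y)); exists x; apply: r_inj.
  by rewrite psiE xE ff'; have [-> ->] := rc y.
have psiM : {morph psi : x y / x * y}.
  move=> x y; apply: r_inj; rewrite psiE rM !psiE tM -fM.
  by have [_ ->] := tc x.
(* A corner records no unit; a surjective multiplicative map preserves it nevertheless. *)
have psi1 : psi 1 = 1.
  by have [z zE] := psi_surj 1; rewrite -[LHS]mulr1 -zE -psiM mul1r.
have lin : linear psi.
  by move=> k x y; apply: r_inj; rewrite !linearP /= !psiE !linearP.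
pose phi : {lrmorphism E -> G} := HB.pack psi
  (GRing.isLinear.Build _ _ _ _ psi lin)
  (GRing.isMonoidMorphism.Build _ _ psi (psi1, psiM)).
exists phi; have phi_inj : injective psi.
  move=> x y /(congr1 r); rewrite !psiE => /(congr1 f'); rewrite !f'f.
  have [-> ->] := tc x; have [-> ->] := tc y; exact: t_inj.
have exi y : exists x, psi x == y by have [x <-] := psi_surj y; exists x.
by exists (fun y => xchoose (exi y)) => [x|y]; [apply: phi_inj|];
  apply/eqP; exact: (xchooseP (exi _)).
Qed.

(** * Admissible quotients of the path algebra of a cycle *)

Section PathAlgebra.
Variables (K : fieldType) (Q : quiver).
Local Notation KQ := (path_algebra K Q).

(** The span of the paths of length at least [k], written on coefficients: an ideal against which
    generated ideals can be tested. *)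
Definition coef_vanish (k : nat) (x : KQ) : Prop :=
  forall p : qpath Q, (size (parrows p) < k)%N -> mcoeff p x = 0.

Lemma coef_vanish_mul k l x y :
  coef_vanish k x -> coef_vanish l y -> coef_vanish (k + l) (x * y).
Proof.
move=> xk yl r rkl; rewrite -[x * y]/(pa_mul x y) pa_mul.unlock.
rewrite raddf_sum big_seq big1 // => p px; rewrite raddf_sum big_seq big1 // => q qy.
rewrite /= mcoeffZ; suff -> : mcoeff r (path_mul K p q) = 0 by rewrite mulr0.
have kp : (k <= size (parrows p))%N.
  by rewrite leqNgt; apply/negP => /xk /eqP; apply/negP; rewrite mcoeff_neq0.
have lq : (l <= size (parrows q))%N.
  by rewrite leqNgt; apply/negP => /yl /eqP; apply/negP; rewrite mcoeff_neq0.
rewrite path_mul.unlock; case: eqP => [E|_]; last exact: mcoeff0.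
rewrite path_elt.unlock mcoeffU; case: eqP => // rE.
move: rkl; rewrite -rE /= size_cat ltnNge => /negP; case.
exact: leq_add.
Qed.

Lemma coef_vanish_ideal k : two_sided_ideal (coef_vanish k).
Proof.
split=> [p _|x y xk yk p pk|a x b xk]; first exact: mcoeff0.
  by rewrite mcoeffD xk // yk // addr0.
rewrite -[k]addn0 -[(k + 0)%N]add0n addnA.
by apply: coef_vanish_mul => //; apply: coef_vanish_mul.
Qed.

(** A path of length one has no place among combinations of paths of length at least two. With
    admissibility this makes every arrow nonzero in the quotient. *)
Lemma arrow_not_in_square (a : arrow Q) :
  ~ ideal_pow (@arrow_ideal K Q) 2 (path_elt K (arrow_path a)).
Proof.
have J1 x : arrow_ideal x -> coef_vanish 1 x.
  apply; first exact: coef_vanish_ideal.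
  move=> _ [c ->] p p0; rewrite path_elt.unlock mcoeffU; case: eqP => // pE.
  by rewrite -pE in p0.
(* The second power of the arrow ideal J unfolds to J (J KQ), so the inner product comes first. *)
have J2 x : ideal_mul (@arrow_ideal K Q) (fun=> True) x -> coef_vanish 1 x.
  apply; first exact: coef_vanish_ideal.
  move=> _ [y [z [/J1 y1 _ ->]]]; rewrite -[1%N]addn0; exact: coef_vanish_mul.
move=> H; have : coef_vanish 2 (path_elt K (arrow_path a)).
  apply: H; first exact: coef_vanish_ideal.
  move=> _ [y [z [/J1 y1 /J2 z1 ->]]]; exact: (coef_vanish_mul y1 z1).
move=> /(_ (arrow_path a) isT); rewrite path_elt.unlock mcoeffUU => /eqP.
by rewrite oner_eq0.
Qed.

Lemma ideal_gen_ideal (R : pzRingType) (X : R -> Prop) : two_sided_ideal (ideal_gen X).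
Proof.
split=> [I [I0 _ _] //|x y xX yX I II XI|a x b xX I II XI].
  by have [_ ID _] := II; apply: ID; [apply: xX | apply: yX].
by have [_ _ IM] := II; apply: IM; apply: xX.
Qed.

Lemma ideal_pow_expr (R : pzRingType) (J : R -> Prop) x k : J x -> ideal_pow J k (x ^+ k).
Proof.
move=> Jx; elim: k => // k IH; rewrite exprS => I _; apply.
by exists x, (x ^+ k).
Qed.

End PathAlgebra.

(** * Vertex idempotents and the sum of the arrows in the quotient *)

Section CyclicQuiver.
Variables (K : fieldType) (A : falgType K) (n : nat).
Local Notation Q := (oriented_cycle n).
Variable (pi : {rmorphism path_algebra K Q -> A}).

Definition vertex_idem (v : 'I_n.+1) : A := pi (path_elt K (@trivial_path Q v)).
Definition arrow_elt (v : 'I_n.+1) : A := pi (path_elt K (@arrow_path Q v)).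
Definition arrow_sum : A := \sum_v arrow_elt v.

Lemma elt_mul (p q : qpath Q) :
  pi (path_elt K p) * pi (path_elt K q) = pi (path_mul K p q).
Proof. by rewrite -rmorphM -pa_mul_elt. Qed.

Lemma elt_mulE (p q r : qpath Q) : ptarget p = psource q ->
  psource r = psource p -> parrows r = parrows p ++ parrows q ->
  pi (path_elt K p) * pi (path_elt K q) = pi (path_elt K r).
Proof.
move=> E sr ar; rewrite elt_mul (path_mulE K E); congr (pi (path_elt K _)).
apply: val_inj; rewrite /= [RHS]surjective_pairing; congr pair; exact: esym.
Qed.

Lemma elt_mul0 (p q : qpath Q) : ptarget p != psource q ->
  pi (path_elt K p) * pi (path_elt K q) = 0.
Proof. by move=> E; rewrite elt_mul path_mul0 // rmorph0. Qed.

Lemma vertex_idemM v w :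
  vertex_idem v * vertex_idem w = if v == w then vertex_idem v else 0.
Proof.
case: eqP => [->|/eqP vw]; first exact: elt_mulE.
exact: elt_mul0.
Qed.

Lemma vertex_arrow v w :
  vertex_idem v * arrow_elt w = if v == w then arrow_elt v else 0.
Proof.
case: eqP => [->|/eqP vw]; first exact: elt_mulE.
exact: elt_mul0.
Qed.

Lemma arrow_vertex v w :
  arrow_elt v * vertex_idem w = if ordS v == w then arrow_elt v else 0.
Proof.
case: eqP => [<-|/eqP vw]; first exact: elt_mulE.
exact: elt_mul0.
Qed.

Lemma vertex_arrow_sum v : vertex_idem v * arrow_sum = arrow_elt v.
Proof.
rewrite mulr_sumr (bigD1 v) //= big1 ?addr0 => [|w wv]; rewrite vertex_arrow ?eqxx //.
by rewrite eq_sym (negbTE wv).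
Qed.

Lemma arrow_sum_vertex v : arrow_sum * vertex_idem (ordS v) = arrow_elt v.
Proof.
rewrite mulr_suml (bigD1 v) //= big1 ?addr0 => [|w wv]; rewrite arrow_vertex ?eqxx //.
by rewrite (inj_eq (can_inj (@ordSK _))) (negbTE wv).
Qed.

(** On an oriented cycle a path is determined by its start and its length. *)
Lemma path_eltE (p : qpath Q) :
  pi (path_elt K p) = vertex_idem (psource p) * arrow_sum ^+ size (parrows p).
Proof.
case: p => -[v s] /=; rewrite /psource /parrows /=; elim: s v => [|a s IH] v comp.
  by rewrite expr0 mulr1; congr (pi (path_elt K _)); apply: val_inj.
have /= /andP[/eqP va comp'] := comp.
have E := @elt_mulE (@arrow_path Q a) (@QPath Q (ordS a, s) comp')
  (@QPath Q (v, a :: s) comp).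
rewrite -E //= IH -[pi _]/(arrow_elt a) -va.
by rewrite mulrA arrow_vertex eqxx exprS mulrA vertex_arrow_sum.
Qed.

Lemma vertex_sum : \sum_v vertex_idem v = 1.
Proof. by rewrite -(rmorph1 pi) -rmorph_sum. Qed.

Lemma nakayama_datum (I : path_algebra K Q -> Prop) :
  admissible I -> scalable pi -> (forall a, exists x, pi x = a) ->
  (forall x, pi x = 0 <-> I x) ->
  exists m, nakayama RightSide vertex_idem (@ordS n.+1) (@ord_pred n.+1) arrow_sum m.
Proof.
move=> [_ I2 [m _ Im]] piZ pi_surj pi0; exists m; split.
- exact: vertex_idemM.
- exact: vertex_sum.
- by move=> v; rewrite /= vertex_arrow_sum arrow_sum_vertex.
- exact: ordSK.
- exact: ord_predK.
(* The sum of the arrows lies in the arrow ideal, whose [m]-th power is contained in [I]. *)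
- rewrite /arrow_sum /arrow_elt -rmorph_sum -rmorphXn; apply/pi0/Im/ideal_pow_expr.
  have [J0 JD _] := ideal_gen_ideal
    (fun x => exists a : arrow Q, x = path_elt K (arrow_path a)).
  apply: (big_ind (@arrow_ideal K Q)) => //= v _ J _; apply.
  by exists v.
- move=> v; rewrite /= vertex_arrow_sum; apply/eqP => /pi0 /I2.
  exact: arrow_not_in_square.
- move=> P P0 Plin Pgen a; have [x <-] := pi_surj a; rewrite [x]pa_eltE rmorph_sum /=.
  apply: (big_ind P) => //.
    by move=> y z Py Pz; rewrite -[y]scale1r; exact: Plin.
  move=> p _; rewrite -[pi _]addr0 piZ path_eltE; apply: Plin => //; exact: Pgen.
Qed.

End CyclicQuiver.

(** * The syzygy and cosyzygy filtered algebras *)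

Lemma mod_iso_sym (K : fieldType) (A : falgType K) (s : side) (M N : fdmod A s) :
  mod_iso M N -> mod_iso N M.
Proof.
move=> [f /homvP fH [f0 fS]]; have ker0 : lker f == 0%VS by apply/eqP.
have fK y : f (f^-1%VF y) = y by rewrite limg_lfunVK // fS memvf.
have finj : injective f by apply/lker0P.
exists f^-1%VF; first by apply/homvP => a y; apply: finj; rewrite fK fH fK.
split.
  apply/eqP/lker0P => y y' /(congr1 f); by rewrite !fK.
apply/vspaceP => x; rewrite memvf; apply/memv_imgP; exists (f x); rewrite ?memvf //.
by rewrite lker0_lfunK.
Qed.

Section FilteredAlgebras.
Variables (K : fieldType) (A : falgType K).
Variables (V : finType) (e : V -> A) (sigma sigma' : V -> V).
Variables (alpha : A) (m : nat).
Hypothesis nkD : nakayama RightSide e sigma sigma' alpha m.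
Local Notation ends := (ends e sigma alpha m).
Local Notation starts := (starts e sigma' alpha m).
Implicit Types (v w : V).

Let nkO : nakayama LeftSide e sigma' sigma alpha m := nakayama_opp nkD.

Lemma sum_reindex k (v : 'I_k -> V) (W : {set V}) : injective v ->
  (forall i, v i \in W) -> (forall y, y \in W -> exists i, y = v i) ->
  \sum_i e (v i) = idem_sum e W.
Proof.
move=> vinj vW Wv; rewrite /idem_sum.
have -> : W = v @: setT.
  apply/setP => y; apply/idP/imsetP => [/Wv[i ->]|[i _ ->]]; first by exists i.
  exact: vW.
rewrite big_imset /=; last by move=> i j _ _; exact: vinj.
by apply: eq_bigl => i; rewrite inE.
Qed.

(** Turns a list of isomorphism classes of simple modules into a list of vertices without
    repetition. It serves the socles with [tau = sigma] and the tops with [tau = sigma']. *)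
Lemma representatives_vertices (C : fdmod A RightSide -> Prop) (W : {set V})
    (tau : V -> V) k (M : 'I_k -> fdmod A RightSide) :
  injective tau ->
  (forall N, C N -> exists w, simple_at e alpha w N /\ tau w \in W) ->
  (forall w, tau w \in W -> exists N, simple_at e alpha w N /\ C N) ->
  (forall v, v \in W -> exists w, v = tau w) ->
  class_representatives C M ->
  exists2 v : 'I_k -> V, forall i, simple_at e alpha (v i) (M i) &
    injective (tau \o v) /\ \sum_i e (tau (v i)) = idem_sum e W.
Proof.
move=> tau_inj CW WC surj [CM Minj Mall].
have /fin_all_exists [v vP] : forall i, exists w, simple_at e alpha w (M i) /\ tau w \in W.
  by move=> i; exact: CW.
have vs i := proj1 (vP i).
have inj : injective (tau \o v).
  move=> i j /tau_inj vij; apply: Minj; apply: (simple_at_iso nkD (vs i)).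
  by rewrite vij; exact: vs.
exists v => //; split=> //; apply: (sum_reindex (v := tau \o v)) => // [i|y yW].
  exact: (proj2 (vP i)).
have [w yE] := surj y yW; rewrite yE in yW *.
have [N [Nw CN]] := WC w yW; have [i iNM] := Mall N CN; exists i.
by rewrite /= (simple_at_inj nkD (simple_iso iNM Nw) (vs i)).
Qed.

Lemma syzygy_filtered_corner (E : algType K) :
  is_syzygy_filtered_algebra A E -> is_corner E (idem_sum e ends).
Proof.
move=> [k [S [tS [P [repS tauS covP endP]]]]].
have [w Sw [winj wsum]] : exists2 v : 'I_k -> V,
    forall i, simple_at e alpha (v i) (S i) &
    injective (sigma \o v) /\ \sum_i e (sigma (v i)) = idem_sum e ends.
  apply: representatives_vertices repS; first exact: can_inj (nk_K nkD).
  - move=> N /(soc_of_proj_injP nkD) [w [Nw [v wv]]]; exists w.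
    by rewrite wv mem_ends.
  - by move=> w /imsetP[v _ wv]; exact: (ex_soc_of_proj_inj nkD wv).
  - by move=> v _; exists (sigma' v); rewrite (nk_K' nkD).
rewrite -wsum.
have [u fu] : exists u : mod_bigsum P, free_on (\sum_i e ((sigma \o w) i)) u.
  apply: (mod_bigsum_free (nk_idem nkD)) => // i.
  have [N trN isoN] := tauS i.
  have tSi : simple_at e alpha (sigma (w i)) (tS i).
    apply: (simple_iso (mod_iso_sym isoN)); apply: simple_dual.
    exact: (transpose_simple nkD (Sw i) trN).
  have [projP [p [pH pS sup]]] := covP i.
  have [u fu _] := proj_cover_simple nkD tSi projP pH pS sup.
  by exists u.
exact: End_corner fu endP.
Qed.

Lemma cosyzygy_filtered_corner (H : algType K) :
  is_cosyzygy_filtered_algebra A H -> is_corner H^c (idem_sum e starts).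
Proof.
move=> [k [T [tT [I [repT tauT envI endI]]]]].
have [w Tw [winj wsum]] : exists2 v : 'I_k -> V,
    forall i, simple_at e alpha (v i) (T i) &
    injective (sigma' \o v) /\ \sum_i e (sigma' (v i)) = idem_sum e starts.
  apply: representatives_vertices repT; first exact: can_inj (nk_K' nkD).
  - move=> N /(top_of_proj_injP nkD) [w [Nw [v wv]]]; exists w.
    by rewrite wv mem_starts.
  - by move=> w /imsetP[v _ wv]; exact: (ex_top_of_proj_inj nkD wv).
  - by move=> v _; exists (sigma v); rewrite (nk_K nkD).
rewrite -wsum.
have [phi fphi] : exists phi : dual (mod_bigsum I),
    free_on (\sum_i e ((sigma' \o w) i)) phi.
  apply: (dual_mod_bigsum_free (nk_idem nkD)) => // i.
  apply: (inj_envelope_simple nkD) (envI i).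
  (* The inverse translate is the transpose of the left module D(T); for the opposite datum the
     rotation is [sigma']. *)
  exact: (transpose_simple nkO (simple_dual (Tw i)) (tauT i)).
exact: dual_End_corner fphi endI.
Qed.

End FilteredAlgebras.

Theorem theorem5p4p5 (K : fieldType) (A : falgType K) (hA : cyclic_nakayama A)
    (E H : algType K)
    (hE : is_syzygy_filtered_algebra A E)
    (hH : is_cosyzygy_filtered_algebra A H) :
  algebra_iso E H^c.
Proof.
have [n [I [pi [adm piZ pi_surj pi0]]]] := hA.
have [m nkD] := nakayama_datum adm piZ pi_surj pi0.
have [f [f' [f'f ff' fc f'c fM]]] := corner_transport nkD.
apply: (corner_algebra_iso f'f ff' fc f'c fM).
  exact: (syzygy_filtered_corner nkD hE).
exact: (cosyzygy_filtered_corner nkD hH).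
Qed.
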